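(* Let $\mathcal{S}=\{\sigma_0,\dots,\sigma_{N-1}\}$, $N\ge 2$, be an arbitrary iterated function system (possibly with essential overlap) on a complete and separable metric space $(Y,d)$, with attractor set $X$ and Hutchinson measure $\mu$, and let $S(X)$ be the collection of all positive operator-valued measures with respect to the pair $(X,L^2(X,\mu))$. For $0\le i\le N-1$ let $F_i:L^2(X,\mu)\to L^2(X,\mu)$ be given by $F_i\phi=\frac{1}{\sqrt{N}}(\phi\circ\sigma_i)$, and let $S_i=F_i^*$. Then there exists a unique positive operator-valued measure $A\in S(X)$ such that $$A(\cdot)=\sum_{i=0}^{N-1}S_i\,A(\sigma_i^{-1}(\cdot))\,S_i^*.$$
   Context: A Lipschitz contraction on $Y$ is a map $L:Y\to Y$ for which there is $r$ with $0<r<1$ and $d(L(x),L(y))\le r\,d(x,y)$ for all $x,y\in Y$. An iterated function system (IFS) on $Y$ is a finite family $\{\sigma_0,\dots,\sigma_{N-1}\}$, $N\ge 2$, of Lipschitz contractions on $Y$. Its attractor set is the unique nonempty compact $X\subseteq Y$ with $X=\bigcup_{i=0}^{N-1}\sigma_i(X)$; each $\sigma_i$ restricts to a map $X\to X$. Its Hutchinson measure is the unique Borel probability measure $\mu$ on $Y$ that integrates all real-valued Lipschitz functions on $Y$ and satisfies $\mu(\cdot)=\frac1N\sum_{i=0}^{N-1}\mu(\sigma_i^{-1}(\cdot))$; its support is $X$. Essential overlap means $\mu(\sigma_i(X)\cap\sigma_j(X))>0$ for some $i\ne j$; no assumption on overlap is made. The operators $F_i$ are bounded and satisfy $\sum_{i=0}^{N-1}F_i^*F_i=\mathrm{id}_{L^2(X,\mu)}$.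 Write $\mathcal{H}=L^2(X,\mu)$, $\mathscr{B}(X)$ for the Borel subsets of $X$ and $\mathcal{B}(\mathcal{H})$ for the bounded operators on $\mathcal{H}$. An operator $L\in\mathcal{B}(\mathcal{H})$ is positive if $\langle Lh,h\rangle\ge 0$ for all $h\in\mathcal{H}$. A positive operator-valued measure (POVM) with respect to the pair $(X,\mathcal{H})$ is a map $A:\mathscr{B}(X)\to\mathcal{B}(\mathcal{H})$ such that: $A(\Delta)$ is a positive operator for all $\Delta\in\mathscr{B}(X)$; $A(\emptyset)=0$ and $A(X)=\mathrm{id}_{\mathcal{H}}$; and for every sequence $\{\Delta_n\}_{n=1}^\infty$ of pairwise disjoint sets in $\mathscr{B}(X)$ and all $g,h\in\mathcal{H}$, $\langle A(\bigcup_{n=1}^\infty\Delta_n)g,h\rangle=\sum_{n=1}^\infty\langle A(\Delta_n)g,h\rangle$. *)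

(* Defs.v *)
From HB Require Import structures.
From mathcomp Require Import all_boot all_order all_algebra.
From mathcomp Require Import generic_quotient sesquilinear.
From mathcomp.real_closed Require Import complex.
From mathcomp Require Import all_classical all_reals all_analysis.
From mathcomp Require Import measurable_realfun ring lra.

Set Implicit Arguments.
Unset Strict Implicit.
Unset Printing Implicit Defensive.

Import Order.TTheory GRing.Theory Num.Theory.
Import numFieldNormedType.Exports.

Local Open Scope classical_set_scope.
Local Open Scope quotient_scope.
Local Open Scope complex_scope.
Local Open Scope ring_scope.

Section L2fun.
Context d (T : measurableType d) (R : realType).
Variables (mu : {measure set T -> \bar R}) (D : set T) (mD : measurable D).
Local Notation C := (R[i]^o).
Local Notation Re := complex.Re.
Local Notation Im := complex.Im.

Definition sqmod (z : R[i]) : R := Re z ^+ 2 + Im z ^+ 2.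

Definition cint (f : T -> C) : R[i] :=
  (\int[mu]_(x in D) Re (f x))%R +i* (\int[mu]_(x in D) Im (f x))%R.

Definition cmeas (f : T -> C) :=
  measurable_fun D (fun x => Re (f x)) /\ measurable_fun D (fun x => Im (f x)).

(* L^2(D, mu) is represented by functions on T of which only the values on D
   matter: measurability, integrals and a.e. equality are all relative to D. *)
Definition sq_integrable (f : T -> C) : Prop :=
  cmeas f /\ mu.-integrable D (fun x => (sqmod (f x))%:E).

(* Measurability of D is recorded in the predicate because the vector space
   structure depends on it. *)
Definition sqint of measurable D : {pred T -> C} := mem [set f | sq_integrable f].
Local Notation sqintD := (sqint mD).

Lemma sqintP f : reflect (sq_integrable f) (f \in sqintD).
Proof. by apply: (iffP idP); rewrite !inE. Qed.

Lemma ReD (z w : R[i]) : Re (z + w) = Re z + Re w.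
Proof. by case: z => a b; case: w. Qed.
Lemma ImD (z w : R[i]) : Im (z + w) = Im z + Im w.
Proof. by case: z => a b; case: w. Qed.
Lemma ReM (z w : R[i]) : Re (z * w) = Re z * Re w - Im z * Im w.
Proof. by case: z => a b; case: w. Qed.
Lemma ImM (z w : R[i]) : Im (z * w) = Re z * Im w + Im z * Re w.
Proof. by case: z => a b; case: w. Qed.

Lemma sqmod_ge0 z : 0 <= sqmod z.
Proof. by rewrite addr_ge0// sqr_ge0. Qed.

Lemma sqmodM z w : sqmod (z * w) = sqmod z * sqmod w.
Proof. by rewrite /sqmod ReM ImM; ring. Qed.

Lemma sqmodD z w : sqmod (z + w) <= 2 * sqmod z + 2 * sqmod w.
Proof.
rewrite /sqmod ReD ImD.
have := sqr_ge0 (Re z - Re w); have := sqr_ge0 (Im z - Im w); nra.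
Qed.

Lemma cmeasD f g : cmeas f -> cmeas g -> cmeas (f + g).
Proof.
move=> [f1 f2] [g1 g2]; split.
  by under eq_fun do rewrite ReD; exact: measurable_funD.
by under eq_fun do rewrite ImD; exact: measurable_funD.
Qed.

Lemma cmeasM f g : cmeas f -> cmeas g -> cmeas (f \* g).
Proof.
move=> [f1 f2] [g1 g2]; split.
  under eq_fun do rewrite ReM.
  by apply: measurable_funB; apply: measurable_funM.
under eq_fun do rewrite ImM.
by apply: measurable_funD; apply: measurable_funM.
Qed.

Lemma cmeas_cst (a : C) : cmeas (cst a).
Proof. by split; exact: measurable_cst. Qed.

Lemma cmeas_conj f : cmeas f -> cmeas (fun x => (f x)^*).
Proof.
move=> [f1 f2]; split.
  by under eq_fun => x do have -> : Re (f x)^* = Re (f x) by case: (f x).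
under eq_fun => x do have -> : Im (f x)^* = - Im (f x) by case: (f x).
exact: measurableT_comp.
Qed.

Lemma cmeas_sqmod f : cmeas f -> measurable_fun D (fun x => sqmod (f x)).
Proof.
by move=> [f1 f2]; apply: measurable_funD; exact: measurable_funX.
Qed.

Lemma sqint0 : (0 : T -> C) \in sqintD.
Proof.
apply/sqintP; split; first exact: (cmeas_cst 0).
rewrite (_ : (fun _ => _) = cst 0%E); first exact: integrable0.
by apply/funext => x; rewrite /sqmod /= expr0n addr0.
Qed.

Lemma sqintDr f g : f \in sqintD -> g \in sqintD -> f + g \in sqintD.
Proof.
move=> /sqintP[mf f2] /sqintP[mg g2]; apply/sqintP.
have mfg := cmeasD mf mg; split => //.
apply: (@le_integrable _ _ _ mu D mD _
   (fun x => (2 * sqmod (f x) + 2 * sqmod (g x))%:E)).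
- by apply/measurable_EFinP; exact: cmeas_sqmod.
- move=> x Dx; rewrite /= lee_fin !ger0_norm ?sqmod_ge0//.
    exact: sqmodD.
  by rewrite addr_ge0// mulr_ge0// sqmod_ge0.
- under eq_fun do rewrite EFinD !EFinM.
  by apply: integrableD => //; apply: integrableZl.
Qed.

Lemma sqintZ (a : R[i]) f : f \in sqintD -> a *: f \in sqintD.
Proof.
move=> /sqintP[mf f2]; apply/sqintP; split.
  exact: (cmeasM (cmeas_cst a) mf).
under eq_fun do rewrite sqmodM EFinM.
by apply: integrableZl.
Qed.

Lemma sqint_submod_closed : submod_closed sqintD.
Proof. by split; [exact: sqint0|move=> a f g ? ?; rewrite sqintDr ?sqintZ]. Qed.

HB.instance Definition _ :=
  GRing.isSubmodClosed.Build _ _ sqintD sqint_submod_closed.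

Record L2fun := MkL2fun { L2fun_val :> T -> C ; _ : L2fun_val \in sqintD }.
HB.instance Definition _ := [isSub for L2fun_val].
HB.instance Definition _ := [Choice of L2fun by <:].
HB.instance Definition _ := [SubChoice_isSubLmodule of L2fun by <:].

Definition ae_eq_L2 (f g : L2fun) := `[< f = g %[ae mu in D] >].

Let ae_refl : reflexive ae_eq_L2.
Proof. by move=> f; apply/asboolP/ae_eq_refl. Qed.

Let ae_sym : symmetric ae_eq_L2.
Proof. by move=> f g; apply/idP/idP => /asboolP h; apply/asboolP/ae_eq_sym. Qed.

Let ae_trans : transitive ae_eq_L2.
Proof.
by move=> f g h /asboolP gf /asboolP fh; apply/asboolP/(ae_eq_trans gf fh).
Qed.

Canonical ae_eq_L2_equiv := EquivRel ae_eq_L2 ae_refl ae_sym ae_trans.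

Definition L2 : Type := {eq_quot ae_eq_L2}.
HB.instance Definition _ := Choice.on L2.
HB.instance Definition _ := EqQuotient.on L2.


Lemma L2fun_sq_integrable (f : L2fun) : sq_integrable f.
Proof. by case: f => f /= /sqintP. Qed.

Lemma eqL2P (f g : L2fun) :
  \pi_L2 f = \pi_L2 g <-> f = g %[ae mu in D].
Proof.
split=> [/eqP|fg]; last by apply/eqP; rewrite eqmodE; apply/asboolP.
by rewrite eqmodE => /asboolP.
Qed.

Lemma repr_ae (f : L2fun) : repr (\pi_L2 f) = f %[ae mu in D].
Proof. by apply/eqL2P; rewrite reprK. Qed.

Definition L2_zero : L2 := \pi_L2 0.
Definition L2_opp (u : L2) : L2 := \pi_L2 (- repr u).
Definition L2_add (u v : L2) : L2 := \pi_L2 (repr u + repr v).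
Definition L2_scale (a : R[i]) (u : L2) : L2 := \pi_L2 (a *: repr u).

Lemma L2_addE (f g : L2fun) : L2_add (\pi_L2 f) (\pi_L2 g) = \pi_L2 (f + g).
Proof.
apply/eqL2P; have := repr_ae f; have := repr_ae g.
by apply: filterS2 => x /= gx fx Dx; rewrite !fctE /= gx ?fx.
Qed.

Lemma L2_oppE (f : L2fun) : L2_opp (\pi_L2 f) = \pi_L2 (- f).
Proof.
apply/eqL2P; have := repr_ae f.
by apply: filterS => x /= fx Dx; rewrite !fctE /= fx.
Qed.

Lemma L2_scaleE a (f : L2fun) : L2_scale a (\pi_L2 f) = \pi_L2 (a *: f).
Proof.
apply/eqL2P; have := repr_ae f.
by apply: filterS => x /= fx Dx; rewrite !fctE /= fx.
Qed.

Let L2_addA : associative L2_add.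
Proof.
elim/quotW=> f; elim/quotW=> g; elim/quotW=> h.
by rewrite (L2_addE g h) (L2_addE f g) (L2_addE f (g + h)) (L2_addE (f + g) h)
           addrA.
Qed.

Let L2_addC : commutative L2_add.
Proof. by elim/quotW=> f; elim/quotW=> g; rewrite (L2_addE f g) (L2_addE g f) addrC. Qed.

Let L2_add0 : left_id L2_zero L2_add.
Proof. by elim/quotW=> f; rewrite (L2_addE 0 f) add0r. Qed.

Let L2_addN : left_inverse L2_zero L2_opp L2_add.
Proof. by elim/quotW=> f; rewrite (L2_oppE f) (L2_addE (- f) f) addNr. Qed.

HB.instance Definition _ :=
  GRing.isZmodule.Build L2 L2_addA L2_addC L2_add0 L2_addN.

Let L2_scaleA a b v : L2_scale a (L2_scale b v) = L2_scale (a * b) v.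
Proof. by elim/quotW: v => f; rewrite (L2_scaleE b f) !L2_scaleE scalerA. Qed.

Let L2_scale1 : left_id 1 L2_scale.
Proof. by elim/quotW=> f; rewrite L2_scaleE scale1r. Qed.

Let L2_scaleDr : right_distributive L2_scale +%R.
Proof.
move=> a; elim/quotW=> f; elim/quotW=> g.
rewrite -[\pi_L2 f + _]/(L2_add _ _) -[RHS]/(L2_add _ _) (L2_addE f g).
by rewrite !L2_scaleE (L2_addE (a *: f) (a *: g)) scalerDr.
Qed.

Let L2_scaleDl v : {morph L2_scale^~ v : a b / a + b}.
Proof.
elim/quotW: v => f a b.
rewrite -[RHS]/(L2_add _ _) !L2_scaleE (L2_addE (a *: f) (b *: f)).
by rewrite scalerDl.
Qed.

HB.instance Definition _ := GRing.Zmodule_isLmodule.Build R[i] L2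
  L2_scaleA L2_scale1 L2_scaleDr L2_scaleDl.

Lemma piD (f g : L2fun) : \pi_L2 (f + g) = \pi_L2 f + \pi_L2 g.
Proof. by rewrite -[RHS]/(L2_add _ _) L2_addE. Qed.

Lemma piZ a (f : L2fun) : \pi_L2 (a *: f) = a *: \pi_L2 f.
Proof. by rewrite -[RHS]/(L2_scale _ _) L2_scaleE. Qed.

Definition cintegrable (f : T -> C) :=
  mu.-integrable D (fun x => (Re (f x))%:E) /\
  mu.-integrable D (fun x => (Im (f x))%:E).

Lemma cintD f g : cintegrable f -> cintegrable g ->
  cint (f \+ g) = cint f + cint g.
Proof.
move=> [f1 f2] [g1 g2]; rewrite /cint.
under eq_Rintegral do rewrite ReD.
rewrite RintegralD//.
under [X in _ +i* X]eq_Rintegral do rewrite ImD.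
by rewrite RintegralD.
Qed.

Lemma cintZ (a : R[i]) f : cintegrable f -> cint (fun x => a * f x) = a * cint f.
Proof.
move=> [f1 f2]; rewrite /cint; case: a => a b /=.
have i1 c : mu.-integrable D (EFin \o (fun x => c * Re (f x))).
  exact: (integrableZl mD c f1).
have i2 c : mu.-integrable D (EFin \o (fun x => c * Im (f x))).
  exact: (integrableZl mD c f2).
under eq_Rintegral do rewrite ReM /=.
rewrite RintegralB//= !RintegralZl//.
under [X in _ +i* X = _]eq_Rintegral do rewrite ImM /=.
rewrite RintegralD//= !RintegralZl//.
Qed.

Lemma cint_conj f : cintegrable f -> cint (fun x => (f x)^*) = (cint f)^*.
Proof.
move=> [f1 f2]; rewrite /cint /=; congr (_ +i* _).
  by apply: eq_Rintegral => x _; case: (f x).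
rewrite -mulN1r -RintegralZl//.
by apply: eq_Rintegral => x _; case: (f x) => a b; rewrite /= mulN1r.
Qed.

Lemma eq_cint f g : cmeas f -> cmeas g -> f = g %[ae mu in D] ->
  cint f = cint g.
Proof.
move=> [f1 f2] [g1 g2] fg; rewrite /cint /Rintegral; congr (fine _ +i* fine _).
  apply: ae_eq_integral => //; try exact/measurable_EFinP.
  by move: fg; apply: filterS => x /= fg Dx; rewrite fg.
apply: ae_eq_integral => //; try exact/measurable_EFinP.
by move: fg; apply: filterS => x /= fg Dx; rewrite fg.
Qed.

Lemma cintegrableM f g : sq_integrable f -> sq_integrable g ->
  cintegrable (fun x => f x * (g x)^*).
Proof.
move=> [mf f2] [mg g2].
have [m1 m2] := cmeasM mf (cmeas_conj mg).
have fg : mu.-integrable D (fun x => (sqmod (f x) + sqmod (g x))%:E).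
  by under eq_fun do rewrite EFinD; exact: integrableD.
have Rb z w : `|Re (z * w^*)| <= sqmod z + sqmod w.
  case: z => a b; case: w => a' b'; rewrite ler_norml /sqmod /=.
  apply/andP; split.
    have := sqr_ge0 (a + a'); have := sqr_ge0 (b + b').
    have := sqr_ge0 a; have := sqr_ge0 a'; have := sqr_ge0 b.
    have := sqr_ge0 b'; nra.
  have := sqr_ge0 (a - a'); have := sqr_ge0 (b - b').
  have := sqr_ge0 a; have := sqr_ge0 a'; have := sqr_ge0 b.
  have := sqr_ge0 b'; nra.
have Ib z w : `|Im (z * w^*)| <= sqmod z + sqmod w.
  case: z => a b; case: w => a' b'; rewrite ler_norml /sqmod /=.
  apply/andP; split.
    have := sqr_ge0 (a - b'); have := sqr_ge0 (b + a').
    have := sqr_ge0 a; have := sqr_ge0 a'; have := sqr_ge0 b.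
    have := sqr_ge0 b'; nra.
  have := sqr_ge0 (a + b'); have := sqr_ge0 (b - a').
  have := sqr_ge0 a; have := sqr_ge0 a'; have := sqr_ge0 b.
  have := sqr_ge0 b'; nra.
have sg x : 0 <= sqmod (f x) + sqmod (g x) by apply: addr_ge0; exact: sqmod_ge0.
split; apply: (le_integrable mD _ _ fg).
- by apply/measurable_EFinP; exact: m1.
- by move=> x _; rewrite /= lee_fin [leRHS]ger0_norm//; exact: sg.
- by apply/measurable_EFinP; exact: m2.
- by move=> x _; rewrite /= lee_fin [leRHS]ger0_norm//; exact: sg.
Qed.

Definition L2fun_ip (f g : T -> C) : R[i] := cint (fun x => f x * (g x)^*).

Definition L2_ip (u v : L2) : R[i] := L2fun_ip (repr u) (repr v).

Lemma L2_ipE (f g : L2fun) : L2_ip (\pi_L2 f) (\pi_L2 g) = L2fun_ip f g.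
Proof.
have mL (h : L2fun) : cmeas h by have [] := L2fun_sq_integrable h.
apply: eq_cint; [exact: cmeasM (mL _) (cmeas_conj (mL _))..|].
have := repr_ae f; have := repr_ae g.
by apply: filterS2 => x /= gx fx Dx; rewrite gx ?fx.
Qed.

Lemma L2_ip_conj u v : L2_ip u v = (L2_ip v u)^*.
Proof.
rewrite /L2_ip /L2fun_ip -cint_conj; last first.
  by apply: cintegrableM; exact: L2fun_sq_integrable.
congr cint; apply/funext => x.
by case: (repr u x) => a b; case: (repr v x) => a' b'; congr (_ +i* _) => /=; ring.
Qed.

Lemma L2_ipDl u v w : L2_ip (u + v) w = L2_ip u w + L2_ip v w.
Proof.
elim/quotW: u => f; elim/quotW: v => g; elim/quotW: w => h.
rewrite -piD !L2_ipE /L2fun_ip -cintD; last 2 first.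
- by apply: cintegrableM; exact: L2fun_sq_integrable.
- by apply: cintegrableM; exact: L2fun_sq_integrable.
by congr cint; apply/funext => x; exact: mulrDl.
Qed.

Lemma L2_ipZl a u w : L2_ip (a *: u) w = a * L2_ip u w.
Proof.
elim/quotW: u => f; elim/quotW: w => h.
rewrite -piZ !L2_ipE /L2fun_ip -cintZ; last first.
  by apply: cintegrableM; exact: L2fun_sq_integrable.
by congr cint; apply/funext => x; rewrite [RHS]mulrA.
Qed.

Let L2_ipl v : zmod_morphism (L2_ip ^~ v).
Proof. by move=> u w; rewrite L2_ipDl -scaleN1r L2_ipZl mulN1r. Qed.

Let L2_ipr u : zmod_morphism (L2_ip u).
Proof. by move=> v w; rewrite !(L2_ip_conj u) L2_ipl rmorphB. Qed.

Let L2_scall v : scalable_for *%R (L2_ip ^~ v).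
Proof. by move=> a u; exact: L2_ipZl. Qed.

Let L2_scalr u : scalable_for (conjc \; *%R) (L2_ip u).
Proof. by move=> a v; rewrite !(L2_ip_conj u) L2_ipZl rmorphM. Qed.

HB.instance Definition _ := isBilinear.Build R[i] L2 L2 R[i] _ _ L2_ip
  L2_ipl L2_ipr L2_scall L2_scalr.

Let L2_herm (u v : L2) : L2_ip u v = (-1) ^+ false * (L2_ip v u)^*.
Proof. by rewrite mul1r; exact: L2_ip_conj. Qed.

HB.instance Definition _ :=
  isHermitianSesquilinear.Build R[i] L2 false (@conjc R) L2_ip L2_herm.

Let L2_ip_gt0 u : u != 0 -> 0 < L2_ip u u.
Proof.
elim/quotW: u => f f0; rewrite L2_ipE.
have -> : L2fun_ip f f = (\int[mu]_(x in D) sqmod (f x))%R%:C.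
  congr (_ +i* _).
    apply: eq_Rintegral => x _; rewrite /sqmod; case: (f x) => a b /=; ring.
  rewrite (_ : (fun x => _) = cst 0) ?Rintegral_cst ?mul0r//.
  by apply/funext => x; case: (f x) => a b /=; ring.
have [[mf1 mf2] f2] := L2fun_sq_integrable f.
have f_ge0 : 0 <= \int[mu]_(x in D) sqmod (f x).
  by apply: Rintegral_ge0 => x _; exact: sqmod_ge0.
rewrite ltcR lt_neqAle f_ge0 andbT eq_sym.
apply: contra_neq f0 => int0; apply/eqL2P.
have : (\int[mu]_(x in D) `|(sqmod (f x))%:E| = 0)%E.
  rewrite -[RHS]/(0%:E) -int0 /Rintegral fineK ?integrable_fin_num//.
  by apply: eq_integral => x _; rewrite gee0_abs// lee_fin sqmod_ge0.
move/(ae_eq_integral_abs mu mD (measurable_int _ f2)).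
apply: filterS => x /= fx0 Dx; have [] := fx0 Dx.
rewrite /sqmod; case: (f x) => a b /= /eqP.
by rewrite paddr_eq0 ?sqr_ge0// !sqrf_eq0 => /andP[/eqP -> /eqP ->].
Qed.

HB.instance Definition _ := isDotProduct.Build R[i] L2 L2_ip L2_ip_gt0.


(* The class of a square-integrable function; 0 on other functions. *)
Definition L2_class (f : T -> R[i]) : L2 := \pi_L2 (insubd (0 : L2fun) f).

Lemma L2_class_repr (u : L2) : L2_class (repr u) = u.
Proof. by rewrite /L2_class valKd reprK. Qed.

Lemma eq_L2_class f g : f \in sqintD -> g \in sqintD ->
  L2_class f = L2_class g <-> f = g %[ae mu in D].
Proof. by move=> fL gL; rewrite eqL2P !insubdK. Qed.

Lemma repr_L2_class f : f \in sqintD ->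
  repr (L2_class f) = f %[ae mu in D].
Proof.
by move=> fL; have := repr_ae (insubd 0 f); rewrite insubdK.
Qed.

End L2fun.

Arguments L2_ip {d T R} mu {D} mD.

Notation borelType Y := (g_sigma_algebraType (@open Y)).

Section operators.
Context (R : realType) (H : lmodType R[i]) (ip : {dot H for @conjc R}).

Definition hnorm (u : H) : R := Num.sqrt (complex.Re (ip u u)).

Definition bounded_operator (L : H -> H) :=
  linear L /\ exists M : R, forall u, hnorm (L u) <= M * hnorm u.

Definition positive_operator (L : H -> H) := forall h, 0 <= ip (L h) h.

(* Hilbert-space adjoint; it is unique when it exists, and the default value
   of the choice operator is irrelevant for bounded L on a Hilbert space. *)
Definition adjoint (L : H -> H) : H -> H :=
  xget (fun=> 0) [set L' | bounded_operator L' /\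
                           forall u v, ip (L u) v = ip u (L' v)].

Context (Y : ptopologicalType).

(* For X Borel, these are the Borel sets of the subspace X. *)
Definition borel_subset (X Delta : set Y) :=
  measurable (Delta : set (borelType Y)) /\ Delta `<=` X.

(* Only the values of A on borel_subset X are constrained. *)
Record is_povm (X : set Y) (A : set Y -> H -> H) : Prop := IsPOVM {
  povm_bounded : forall Delta, borel_subset X Delta ->
    bounded_operator (A Delta) ;
  povm_positive : forall Delta, borel_subset X Delta ->
    positive_operator (A Delta) ;
  povm_set0 : A set0 = (fun=> 0) ;
  povm_setT : A X = id ;
  povm_sigma_additive : forall Delta : nat -> set Y,
    (forall n, borel_subset X (Delta n)) -> trivIset [set: nat] Delta ->
    forall g h, (fun n => \sum_(0 <= k < n) ip (A (Delta k) g) h : R[i]^o)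
      @ \oo --> (ip (A (\bigcup_n Delta n) g) h : R[i]^o) }.

End operators.

(* The library's complete spaces and measurable spaces are pointed; a nonempty
   space can be given any base point, which is not used otherwise. *)
#[short(type="completeMetricType")]
HB.structure Definition CompleteMetric (K : numDomainType) :=
  {M of Complete M & Metric K M}.

Definition separable_space (Y : topologicalType) :=
  exists S : set Y, countable S /\ dense S.

Definition lipschitz_contraction (R : realType) (Y : metricType R)
    (L : Y -> Y) :=
  exists r : R, [/\ 0 < r, r < 1 &
                 forall x y, mdist (L x) (L y) <= r * mdist x y].

Definition real_lipschitz (R : realType) (Y : metricType R) (f : Y -> R) :=
  exists k : R, forall x y, `|f x - f y| <= k * mdist x y.

Section ifs.
Context (R : realType) (Y : completeMetricType R) (N : nat).
Variable sigma : 'I_N -> Y -> Y.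

Definition is_attractor (X : set Y) :=
  [/\ X !=set0, compact X & X = \bigcup_(i in [set: 'I_N]) (sigma i @` X)].

Lemma attractor_sub X i : is_attractor X -> X `<=` sigma i @^-1` X.
Proof. by case=> _ _ XE x Xx; rewrite XE; exists i => //; exists x. Qed.

Lemma attractor_measurable X : is_attractor X ->
  measurable (X : set (borelType Y)).
Proof.
move=> [_ cX _]; have /closed_openC oX : closed X.
  by apply: compact_closed => //; exact: metric_hausdorff.
rewrite -[X]setCK; apply: measurableC.
exact: sub_sigma_algebra.
Qed.

Definition is_hutchinson_measure (mu : probability (borelType Y) R) :=
  (forall f : Y -> R, real_lipschitz f -> mu.-integrable [set: Y] (EFin \o f))
  /\ forall B : set (borelType Y), measurable B ->
       (mu B = (N%:R^-1)%:E * \sum_(i < N) mu (sigma i @^-1` B))%E.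

Lemma contraction_measurable (L : Y -> Y) : lipschitz_contraction L ->
  measurable_fun [set: borelType Y] (L : borelType Y -> borelType Y).
Proof.
move=> [r [r0 _ Lr]].
apply: (@measurability _ _ (borelType Y) (borelType Y) _ _ (@open Y)) => //.
move=> _ [B oB <-]; rewrite setTI; apply: sub_sigma_algebra.
have /continuousP : continuous L; last exact.
move=> x; apply/cvg_ballP => e e0.
apply/nbhs_ballP; exists (e / r) => /=; first exact: divr_gt0.
move=> y; rewrite !ballEmdist/= => xy.
by rewrite (le_lt_trans (Lr _ _))// mulrC -ltr_pdivlMr.
Qed.

Section composition.
Variables (X : set Y) (hX : is_attractor X) (mu : probability (borelType Y) R).
Local Notation mX := (attractor_measurable hX).

(* phi |-> N^(-1/2) (phi \o sigma i); comp_sq_integrable and comp_opE below show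
   that the composite is square integrable and that its class does not depend
   on the representative of phi. *)
Definition comp_op (i : 'I_N) (phi : L2 mu mX) : L2 mu mX :=
  L2_class mu mX (fun x : borelType Y => ((Num.sqrt N%:R)^-1)%:C * repr phi (sigma i x)).


Hypotheses (hs : forall j, lipschitz_contraction (sigma j))
           (hmu : is_hutchinson_measure mu).

Lemma hutchinson_sum (B : set (borelType Y)) : (0 < N)%N -> measurable B ->
  (N%:R%:E * mu B = \sum_(i < N) mu (sigma i @^-1` B))%E.
Proof.
move=> N0 mB; rewrite hmu.2// muleA -EFinM divff ?mul1e//.
by rewrite pnatr_eq0 -lt0n.
Qed.

Lemma hutchinson_integral_le (g : borelType Y -> \bar R) i :
  measurable_fun [set: borelType Y] g -> (forall y, 0 <= g y)%E ->
  (\int[mu]_y g (sigma i y) <= N%:R%:E * \int[mu]_y g y)%E.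
Proof.
move=> mg g0; have N0 : (0 < N)%N by case: i => k; case: (N).
have ms (k : nat) := contraction_measurable (hs (insubd i k)).
pose m (k : nat) : {measure set (borelType Y) -> \bar R} :=
  measure_function_pushforward__canonical__measure_function_Measure mu (ms k).
have mE k : (\int[m k]_y g y = \int[mu]_y g (sigma (insubd i k) y))%E.
  exact: (ge0_integral_pushforward (ms k) mu measurableT mg).
have <- : (\int[mscale (NngNum (ler0n R N)) mu]_y g y = N%:R%:E * \int[mu]_y g y)%E.
  exact: ge0_integral_mscale.
have -> : (\int[mscale (NngNum (ler0n R N)) mu]_y g y = \int[msum m N]_y g y)%E.
  apply: eq_measure_integral => A mA _.
  apply: (etrans (hutchinson_sum N0 mA)).
  by apply: eq_bigr => k _; rewrite /m /pushforward /= valKd.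
rewrite ge0_integral_measure_sum// (bigD1 i)//= mE valKd.
by rewrite leeDl// sume_ge0// => k _; exact: integral_ge0.
Qed.

Lemma comp_negligible i (A : set (borelType Y)) :
  mu.-negligible A -> mu.-negligible (sigma i @^-1` A).
Proof.
have N0 : (0 < N)%N by case: i => k; case: (N).
move=> [B [mB B0 AB]]; exists (sigma i @^-1` B); split.
- rewrite -[X in measurable X]setTI.
  by apply: (contraction_measurable (hs i)).
- have := hutchinson_sum N0 mB; rewrite B0 mule0 => S0.
  apply/eqP; rewrite -measure_le0 S0 (bigD1 i)//= leeDl//.
  by rewrite sume_ge0.
- by move=> x /AB.
Qed.

Lemma comp_sq_integrable i (f : L2fun mu mX) :
  (fun x : borelType Y => ((Num.sqrt N%:R)^-1)%:C * f (sigma i x)) \in sqint mu mX.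
Proof.
have [[mf1 mf2] f2] := L2fun_sq_integrable f.
have Xs := @attractor_sub X i hX.
have msX : measurable_fun (X : set (borelType Y)) (sigma i : borelType Y -> borelType Y).
  exact: measurable_funTS (contraction_measurable (hs i)).
have cX d (T : measurableType d) (g : borelType Y -> T) :
    measurable_fun (X : set (borelType Y)) g ->
    measurable_fun (X : set (borelType Y)) (fun x => g (sigma i x)).
  by move=> mg; apply: (measurable_comp mX _ mg msX) => _ [x Xx <-]; exact: Xs.
suff : (fun x : borelType Y => f (sigma i x) : R[i]^o) \in sqint mu mX.
  exact: sqintZ.
apply/sqintP; split; first split.
- exact: (cX _ _ _ mf1).
- exact: (cX _ _ _ mf2).
have msq : measurable_fun (X : set (borelType Y)) (fun x => (sqmod (f x))%:E).
  exact: measurable_int f2.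
apply/integrableP; split; first exact: (cX _ _ _ msq).
pose g : borelType Y -> \bar R := (fun x => (sqmod (f x))%:E) \_ X.
have g0 y : (0 <= g y)%E.
  by rewrite /g patchE; case: ifPn => // _; rewrite lee_fin sqmod_ge0.
have mg : measurable_fun [set: borelType Y] g by apply/(measurable_restrictT _ mX).
have gsq : (\int[mu]_y g y = \int[mu]_(x in X) `|(sqmod (f x))%:E|)%E.
  rewrite [RHS]integral_mkcond; apply: eq_integral => y _.
  by rewrite /g !patchE; case: ifPn => // _; rewrite gee0_abs// lee_fin sqmod_ge0.
apply: (@le_lt_trans _ _ (\int[mu]_y g (sigma i y))%E).
  rewrite integral_mkcond; apply: ge0_le_integral => //.
  - by move=> y _; rewrite patchE; case: ifPn.
  - apply/(measurable_restrictT _ mX); apply: measurableT_comp => //.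
    exact: (cX _ _ _ msq).
  - exact: (measurableT_comp mg (contraction_measurable (hs i))).
  - move=> y _; rewrite patchE; case: ifPn => // /set_mem Xy.
    rewrite /g patchE mem_set; last exact: Xs.
    by rewrite gee0_abs// lee_fin sqmod_ge0.
apply: le_lt_trans (hutchinson_integral_le i mg g0) _.
by rewrite gsq lte_mul_pinfty//; case/integrableP : f2.
Qed.

Lemma comp_opE i (f : L2fun mu mX) : comp_op i (\pi_(L2 mu mX) f) =
  L2_class mu mX (fun x : borelType Y => ((Num.sqrt N%:R)^-1)%:C * f (sigma i x)).
Proof.
apply/eq_L2_class; try exact: comp_sq_integrable.
apply: negligibleS (comp_negligible i (repr_ae f)) => x /= nx fx; apply: nx => Xx.
by rewrite fx//; exact: (attractor_sub i hX Xx).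
Qed.

End composition.
End ifs.

Arguments comp_op {R Y N sigma X} hX mu i phi.

(* Main.v *)
Require Import Defs.
From HB Require Import structures.
From mathcomp Require Import all_boot all_order all_algebra.
From mathcomp Require Import sesquilinear.
From mathcomp.real_closed Require Import complex.
From mathcomp Require Import all_classical all_reals all_analysis.
From mathcomp Require Import generic_quotient measurable_realfun ring lra.

Set Implicit Arguments.
Unset Strict Implicit.
Unset Printing Implicit Defensive.

Import Order.TTheory GRing.Theory Num.Theory.
Import numFieldNormedType.Exports.

Local Open Scope classical_set_scope.
Local Open Scope ring_scope.

(** Write [F_i] for the composition operators, [S_i] for their adjoints and [M_D]
    for the multiplication by the indicator function of a Borel subset [D] of
    the attractor [X].

    Existence. The POVM [D |-> M_D] is a solution, whatever the overlaps of the
    pieces [sigma_i (X)] are: since [1_D o sigma_i] is the indicator of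
    [sigma_i^-1 (D)], one has [F_i M_D = M_(sigma_i^-1 (D)) F_i]
    (comp_op_restrict), whence
    [\sum_i S_i M_(sigma_i^-1 (D)) F_i = (\sum_i S_i F_i) M_D = M_D].
    The identity [\sum_i S_i F_i = id] is the invariance of the Hutchinson
    measure (sq_norm_comp_op), once it is known that the measure is carried by
    [X] (hutchinson_attractor).

    The adjoints. [S_i] has to be shown to exist. For a nonnegative square
    integrable [k], the image under [sigma_i] of the measure [k mu] is
    absolutely continuous, and its Radon-Nikodym derivative [w] satisfies
    [\int (g o sigma_i) k = \int g w]; testing this on truncations of [w]
    shows that [w] is square integrable (transfer_density,
    transfer_density_sq). By linearity every vector has an adjoint image
    (comp_op_weak_adjoint), and boundedness is automatic
    (adjoint_of_contraction).

    Uniqueness. Let [A] and [B] be two solutions and [q_A (D, h) = <A(D) h, h>],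
    so that [q_A (D, h) = \sum_i q_A (sigma_i^-1 (D), F_i h)], and likewise for
    [B]. Suppose that every point of [X] at distance less than [e] from [C]
    belongs to [D]. Taking preimages under the contractions magnifies this gap
    by a factor at least [1 / r] with [r < 1], so that after finitely many steps
    it exceeds the diameter of [X]; then either the inner set is empty or the
    outer one is [X], and [q_A <= q_B] is clear from [A(X) = B(X) = id]. Hence
    [q_A (C, h) <= q_B (D, h)] (self_similar_le_gap). Exhausting an open set from
    inside by sets with a positive gap gives [q_A <= q_B] on open sets, hence
    equality by symmetry. Finite measures that agree on open sets agree on Borel
    sets, and polarization recovers [A = B] (self_similar_uniq). *)

(** * Operators on a space with a complex inner product *)

Section operators.
Local Open Scope complex_scope.
Context (R : realType) (H : lmodType R[i]) (ip : {dot H for @conjc R}).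
Local Notation Re := complex.Re.
Local Notation Im := complex.Im.

Lemma ip_conj u v : ip u v = (ip v u)^*.
Proof. by rewrite hermC expr0 mul1r. Qed.

Lemma ip_ge0 u : 0 <= ip u u.
Proof.
by have [->|u0] := eqVneq u 0; [rewrite linear0l|exact/ltW/neq0_dnorm_gt0].
Qed.

Lemma ip_ReE u : ip u u = (Re (ip u u))%:C.
Proof.
by have := ger0_Im (ip_ge0 u); case: (ip u u) => a b /= ->.
Qed.

Lemma Re_ip_ge0 u : 0 <= Re (ip u u).
Proof. by have := ip_ge0 u; rewrite lecE => /andP[]. Qed.

Lemma ip_inj u v : (forall w, ip w u = ip w v) -> u = v.
Proof.
move=> uv; apply/eqP; rewrite -subr_eq0; apply/eqP.
have [//|/(neq0_dnorm_gt0 (s := ip))] := eqVneq (u - v) 0.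
by rewrite linearBr /= uv subrr ltxx.
Qed.

Lemma Re_ip_le u v : Re (ip u v) <= (Re (ip u u) + Re (ip v v)) / 2.
Proof.
have := Re_ip_ge0 (u - v); rewrite linearBl !linearBr /= (ip_conj v u).
by rewrite !raddfB /=; case: (ip u v) => a b /=; lra.
Qed.

(** With complex scalars, the diagonal values at [u + w] and at [u + i w]
    determine the value of a sesquilinear form at [(u, w)]. *)
Lemma polarization (L L' : H -> H) : linear L -> linear L' ->
  (forall h, ip (L h) h = ip (L' h) h) -> L = L'.
Proof.
move=> lL lL' LL'.
pose f u v : R[i] := ip (L u) v - ip (L' u) v.
have fD u v w : f (u + v) w = f u w + f v w.
  have := lL 1 u v; have := lL' 1 u v; rewrite !scale1r /f => -> ->.
  by rewrite !linearDl; ring.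
have L0 (M : H -> H) : linear M -> M 0 = 0.
  by move=> lM; have := lM (-1) 0 0; rewrite scaler0 addr0 scaleN1r addNr.
have fZ (a : R[i]) u w : f (a *: u) w = a * f u w.
  have := lL a u 0; have := lL' a u 0; rewrite !addr0 /f => -> ->.
  by rewrite (L0 _ lL) (L0 _ lL') !addr0 !linearZl_LR /= mulrBr.
have fDr u v w : f w (u + v) = f w u + f w v.
  by rewrite /f !linearDr; ring.
have fZr (a : R[i]) u w : f w (a *: u) = conjc a * f w u.
  by rewrite /f !linearZr_LR /= mulrBr.
have f0 u : f u u = 0 by rewrite /f LL' subrr.
apply/funext => u; apply/ip_inj => w; rewrite ip_conj [RHS]ip_conj.
congr conjc; apply/eqP; rewrite -subr_eq0; apply/eqP; rewrite -[LHS]/(f u w).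
have e1 : f u w + f w u = 0.
  by have := f0 (u + w); rewrite fD !fDr !f0 add0r addr0.
have := f0 (u + (0 +i* 1 : R[i]) *: w).
rewrite fD !fDr !fZ !fZr !f0 !mulr0 add0r addr0.
move: e1; case: (f u w) => a b; case: (f w u) => c d.
move=> /eqP + /eqP; rewrite !eq_complex /= => /andP[/eqP ? /eqP ?].
by move=> /andP[/eqP ? /eqP ?]; congr (_ +i* _); lra.
Qed.

Lemma bounded_of_contraction (L : H -> H) : linear L ->
  (forall u, Re (ip (L u) (L u)) <= Re (ip u u)) -> bounded_operator ip L.
Proof.
move=> lL cL; split=> //; exists 1 => u; rewrite mul1r.
by rewrite ler_wsqrtr.
Qed.

Lemma adjoint_uniq (L L' : H -> H) : bounded_operator ip L' ->
  (forall u v, ip (L u) v = ip u (L' v)) -> adjoint ip L = L'.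
Proof.
move=> bL' LL'; rewrite /adjoint; case: xgetP => [L2 _ [_ LL2]|]; last first.
  by move=> /(_ L')/(_ (conj bL' LL')).
by apply/funext => v; apply: ip_inj => u; rewrite -LL2 LL'.
Qed.

(** A weakly defined adjoint of a contraction is automatically a bounded
    operator: it is linear because the inner product separates points, and
    [|w|^2 = Re <L w, v> <= (|w|^2 + |v|^2) / 2] for [w] the image of [v]. *)
Lemma adjoint_of_contraction (L : H -> H) : linear L ->
  (forall u, Re (ip (L u) (L u)) <= Re (ip u u)) ->
  (forall v, exists w, forall u, ip (L u) v = ip u w) ->
  bounded_operator ip (adjoint ip L) /\
  forall u v, ip (L u) v = ip u (adjoint ip L v).
Proof.
move=> lL cL /choice[L' LL'].
have bL' : bounded_operator ip L'.
  apply: bounded_of_contraction.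
    move=> a u v; apply: ip_inj => w; rewrite -LL' linearDr linearZr_LR /=.
    by rewrite !LL' linearDr linearZr_LR.
  move=> v; have := Re_ip_le (L (L' v)) v; have := cL (L' v).
  by rewrite (LL' v (L' v)); lra.
by rewrite (adjoint_uniq bL' (fun u v => LL' v u)); split.
Qed.

Lemma adjoint_adjoint (L : H -> H) : bounded_operator ip L ->
  (forall u v, ip (L u) v = ip u (adjoint ip L v)) ->
  adjoint ip (adjoint ip L) = L.
Proof.
move=> bL LL'; apply: adjoint_uniq => // u v.
by rewrite ip_conj -LL' -ip_conj.
Qed.

End operators.

(** * Complex limits and the scalar measures of a POVM *)

Section complex_limits.
Local Open Scope complex_scope.
Context (R : realType).
Implicit Types (u : nat -> R[i]^o) (l : R[i]^o).
Local Notation Re := complex.Re.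
Local Notation Im := complex.Im.

Lemma normc_ge_Re (z : R[i]) : `|Re z|%:C <= `|z|.
Proof.
rewrite normc_def lecR -sqrtr_sqr ler_wsqrtr// lerDl; exact: sqr_ge0.
Qed.

Lemma cvg_Re u l : u @ \oo --> l -> (Re (u n) : R^o) @[n --> \oo] --> (Re l : R^o).
Proof.
move=> /cvgrPdist_lt ul; apply/cvgrPdist_lt => e e0.
have [|k _ uk] := ul (e%:C); first by rewrite ltcR.
exists k => // n kn; rewrite -(ltcR (R := R)).
by apply: le_lt_trans (uk n kn); rewrite -raddfB; exact: normc_ge_Re.
Qed.

Lemma cvg_complex u l :
  (Re (u n) : R^o) @[n --> \oo] --> (Re l : R^o) ->
  (Im (u n) : R^o) @[n --> \oo] --> (Im l : R^o) ->
  u @ \oo --> l.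
Proof.
move=> /cvgrPdist_lt ur /cvgrPdist_lt ui; apply/cvgrPdist_lt => e e0.
have [eR e0'] : e = (Re e)%:C /\ 0 < Re e.
  by move: e0; rewrite ltcE; case: (e) => a b /= /andP[/eqP -> ->].
have e2 : 0 < Re e / 2 by rewrite divr_gt0.
have [k _ urk] := ur _ e2; have [m _ uim] := ui _ e2.
exists (maxn k m) => // n; rewrite /= geq_max => /andP[/urk/= r /uim/= i].
rewrite eR; case: (u n) r i => a b; case: (l) => c d /= r i.
have -> : (c +i* d : R[i]) - (a +i* b) = (c - a)%:C + (d - b)*i.
  by congr (_ +i* _) => /=; rewrite ?addr0 ?add0r.
apply: le_lt_trans (ler_normD _ _) _.
rewrite !normc_def /= !expr0n /= addr0 add0r !sqrtr_sqr -raddfD /= ltcR.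
by rewrite (splitr (Re e)) ltrD.
Qed.

End complex_limits.

Section povm_measure.
Local Open Scope complex_scope.
Context (R : realType) (H : lmodType R[i]) (ip : {dot H for @conjc R}).
Context (Y : ptopologicalType) (X : set Y).
Hypothesis mX : measurable (X : set (borelType Y)).
Context (A : set Y -> H -> H) (povmA : is_povm ip X A) (h : H).
Local Notation Re := complex.Re.
Local Notation Im := complex.Im.

Lemma borel_subsetI (D : set (borelType Y)) :
  measurable D -> borel_subset X (X `&` D).
Proof. by move=> mD; split; [exact: measurableI|exact: subIsetl]. Qed.

(** The maximum with 0 makes the value nonnegative on every set, as a measure
    must be; a POVM takes arbitrary values on non-Borel sets. *)
Definition povm_mass (D : set (borelType Y)) : \bar R :=
  (Num.max 0 (Re (ip (A (X `&` D) h) h)))%:E.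

Lemma povm_massE D : measurable D ->
  povm_mass D = (Re (ip (A (X `&` D) h) h))%:E.
Proof.
move=> mD; rewrite /povm_mass max_r//.
by have := povm_positive povmA (borel_subsetI mD) h; rewrite lecE => /andP[].
Qed.

Let mass0 : povm_mass set0 = 0%E.
Proof.
by rewrite povm_massE// setI0 (povm_set0 povmA) linear0l.
Qed.

Let mass_ge0 D : (0 <= povm_mass D)%E.
Proof. by rewrite lee_fin le_max lexx. Qed.

Let mass_sigma_additive : semi_sigma_additive povm_mass.
Proof.
move=> D mD tD mUD; rewrite povm_massE// setI_bigcupr.
have XD n : borel_subset X (X `&` D n) by exact: borel_subsetI.
have tXD : trivIset setT (fun n => X `&` D n) by exact: trivIset_setIl.
have := cvg_Re (povm_sigma_additive povmA XD tXD (g := h) (h := h)).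
under eq_fun do rewrite raddf_sum /=.
move=> cA; rewrite (_ : (fun n => _) =
  EFin \o (fun n => (\sum_(0 <= k < n) Re (ip (A (X `&` D k) h) h)))); last first.
  apply/funext => n /=; rewrite -sumEFin.
  by apply: eq_bigr => k _; rewrite povm_massE.
by apply: cvg_comp cA _; exact: cvg_id.
Qed.

HB.instance Definition _ := isMeasure.Build _ _ _ povm_mass
  mass0 mass_ge0 mass_sigma_additive.

Definition povm_measure : {measure set (borelType Y) -> \bar R} := povm_mass.

Lemma povm_measureE D : measurable D ->
  povm_measure D = (Re (ip (A (X `&` D) h) h))%:E.
Proof. exact: povm_massE. Qed.

Lemma povm_measure_fin D : measurable D -> (povm_measure D < +oo)%E.
Proof. by move=> mD; rewrite povm_measureE// ltry. Qed.

Lemma Re_povm_le (D : set (borelType Y)) : measurable D ->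
  Re (ip (A (X `&` D) h) h) <= Re (ip h h).
Proof.
move=> mD; rewrite -lee_fin -povm_measureE//.
have <- : povm_measure setT = (Re (ip h h))%:E.
  by rewrite povm_measureE// setIT (povm_setT povmA).
by apply: le_measure; rewrite ?inE.
Qed.

End povm_measure.

(** * Contractions and inner approximations of open sets *)

Section contractions.
Context (R : realType) (Y : completeMetricType R) (N : nat).
Variable sigma : 'I_N -> Y -> Y.
Hypothesis sigma_contraction : forall i, lipschitz_contraction (sigma i).

Lemma common_contraction_ratio : exists r : R, [/\ 0 < r, r < 1 &
  forall i x y, mdist (sigma i x) (sigma i y) <= r * mdist x y].
Proof.
have /choice[c cP] := sigma_contraction.
(* The default value 1/2 keeps the ratio positive. *)
exists (\big[Num.max/2^-1]_i c i); split.
- by rewrite (@lt_le_trans _ _ 2^-1) ?invr_gt0// bigmax_ge_id.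
- by apply: bigmax_lt => [|i _]; [rewrite invf_lt1 ?ltr1n|case: (cP i)].
- move=> i x y; case: (cP i) => _ _ /(_ x y)/le_trans; apply.
  by rewrite ler_wpM2r ?mdist_ge0// le_bigmax.
Qed.

Lemma measurable_preimage_contraction i (D : set (borelType Y)) :
  measurable D -> measurable (sigma i @^-1` D : set (borelType Y)).
Proof.
move=> mD; rewrite -[X in measurable X]setTI.
exact: contraction_measurable.
Qed.

Lemma compact_mdist_lt (X : set Y) : compact X ->
  exists2 M : R, 0 < M & forall x y, X x -> X y -> mdist x y < M.
Proof.
move=> cX; have [->|/set0P[x0 Xx0]] := eqVneq X set0; first by exists 1.
have cf : continuous (mdist x0 : Y -> R^o).
  move=> x; apply/cvgrPdist_lt => e e0; near=> y.
  have : mdist x y < e.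
    by near: y; apply/nbhs_ballP; exists e => //= z; rewrite ballEmdist.
  have := metric_triangle x0 y x; have := metric_triangle x0 x y.
  rewrite (metric_sym y x) => *; rewrite ltr_norml; apply/andP; split; lra.
have /compact_bounded[M [_ bM]] : compact ((mdist x0 : Y -> R^o) @` X).
  by apply: continuous_compact => //; apply: continuous_subspaceT.
have {}bM x : X x -> mdist x0 x <= `|M| + 1.
  move=> Xx; apply: le_trans (ler_norm _) _.
  apply: bM; last by exists x.
  by rewrite (le_lt_trans (ler_norm _))// ltrDl.
exists (2 * (`|M| + 2)); first by rewrite mulr_gt0// ltr_wpDl.
move=> x y /bM Xx /bM Xy; have := metric_triangle x x0 y.
by rewrite (metric_sym x x0); lra.
Unshelve. all: by end_near. Qed.

(** An inner approximation of [O] relative to [X]: it is closed, hence Borel,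
    and increases to [O] on [X] as [e] decreases to 0 when [O] is open. *)
Definition inner_set (X O : set Y) (e : R) : set Y :=
  [set x | forall y, X y -> mdist x y < e -> O y].

Lemma measurable_inner_set X O e : measurable (inner_set X O e : set (borelType Y)).
Proof.
rewrite -[X in measurable X]setCK; apply: measurableC.
rewrite (_ : ~` _ = \bigcup_(y in X `\` O) [set x | mdist x y < e]).
  apply: sub_sigma_algebra; apply: bigcup_open => y _.
  rewrite openE => x /= xy; apply/nbhs_ballP; exists (e - mdist x y) => /=.
    by rewrite subr_gt0.
  move=> z; rewrite ballEmdist /= => xz.
  by have := metric_triangle z x y; rewrite (metric_sym z x); lra.
apply/seteqP; split => [x /= /existsNP[y /not_implyP[Xy /not_implyP[xy Oy]]]|].
  by exists y.
by move=> x [y [Xy nOy] xy] /(_ y Xy xy).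
Qed.

Lemma bigcup_inner_set X O (e : nat -> R) : open O -> (forall n, 0 < e n) ->
  e n @[n --> \oo] --> (0 : R^o) ->
  X `&` \bigcup_n (inner_set X O (e n)) = X `&` O.
Proof.
move=> oO e0 /cvgrPdist_lt ce; apply/seteqP; split => x [Xx].
  by move=> [n _ xn]; split => //; apply: xn => //; rewrite mdistxx.
move=> Ox; split => //; have /nbhs_ballP[d /= d0 xd] := open_nbhs_nbhs (conj oO Ox).
have [n _ /(_ n (leqnn n))/= ned] := ce _ d0.
exists n => // y Xy xy; apply: xd; rewrite ballEmdist/=; apply: lt_trans xy _.
by rewrite (le_lt_trans (ler_norm _))// -[e n]subr0 distrC.
Qed.

Lemma inner_set_nondecreasing X O (e : nat -> R) :
  {homo e : m n / (m <= n)%N >-> n <= m} ->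
  nondecreasing_seq (fun n => inner_set X O (e n)).
Proof.
move=> de m n mn; apply/subsetPset => x xm y Xy xy; apply: xm => //.
exact: lt_le_trans xy (de _ _ mn).
Qed.

End contractions.

(** * Uniqueness of self-similar POVMs *)

Section self_similar_povm.
Local Open Scope complex_scope.
Context (R : realType) (Y : completeMetricType R) (N : nat).
Variable sigma : 'I_N -> Y -> Y.
Hypothesis sigma_contraction : forall i, lipschitz_contraction (sigma i).
Context (X : set Y) (cX : compact X) (mX : measurable (X : set (borelType Y))).
Hypothesis sigmaX : forall i x, X x -> X (sigma i x).
Context (H : lmodType R[i]) (ip : {dot H for @conjc R}) (F : 'I_N -> H -> H).
Local Notation Re := complex.Re.
Local Notation Im := complex.Im.

(** The fixed-point equation [A(D) = \sum_i F_i^* A(sigma_i^-1 D) F_i], read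
    on the diagonal of the quadratic forms. *)
Definition self_similar (A : set Y -> H -> H) :=
  forall D : set (borelType Y), measurable D -> forall h,
  ip (A (X `&` D) h) h =
    \sum_(i < N) ip (A (X `&` sigma i @^-1` D) (F i h)) (F i h).

(** Each use of self-similarity magnifies the gap between two sets by a factor
    at least [r^-1]; once the gap exceeds the diameter of [X], either the
    inner set misses [X] or the outer one contains [X]. *)
Lemma self_similar_le_gap (A B : set Y -> H -> H) (r M : R) n
    (C D : set (borelType Y)) h :
  is_povm ip X A -> is_povm ip X B -> self_similar A -> self_similar B ->
  0 < r -> (forall i x y, mdist (sigma i x) (sigma i y) <= r * mdist x y) ->
  (forall x y, X x -> X y -> mdist x y < M) ->
  measurable C -> measurable D ->
  (forall x y, X x -> C x -> X y -> mdist x y < M * r ^+ n -> D y) ->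
  Re (ip (A (X `&` C) h) h) <= Re (ip (B (X `&` D) h) h).
Proof.
move=> povmA povmB ssA ssB r0 rP XM.
elim: n C D h => [|n ih] C D h mC mD CD.
  have [XC0|/set0P[x [Xx Cx]]] := eqVneq (X `&` C) set0.
    rewrite XC0 (povm_set0 povmA) linear0l /=.
    by have := povm_positive povmB (borel_subsetI mX mD) h; rewrite lecE => /andP[].
  rewrite (_ : X `&` D = X).
    by rewrite (povm_setT povmB); exact: (Re_povm_le mX povmA).
  apply/setIidl => y Xy; apply: (CD x) => //.
  by rewrite expr0 mulr1; exact: XM.
rewrite ssA// ssB// !raddf_sum /=; apply: ler_sum => i _.
apply: ih; try exact: measurable_preimage_contraction.
move=> x y Xx Cx Xy xy; apply: (CD (sigma i x)) => //; try exact: sigmaX.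
by apply: le_lt_trans (rP i x y) _; rewrite exprS mulrCA ltr_pM2l.
Qed.

(** The gap of [inner_set X O (M * r ^+ n)] is bridged by [n] steps; letting [n]
    grow, continuity from below gives the inequality on [O] itself. *)
Let le_open (A B : set Y -> H -> H) (O : set Y) h :
  is_povm ip X A -> is_povm ip X B -> self_similar A -> self_similar B ->
  open O -> Re (ip (A (X `&` O) h) h) <= Re (ip (B (X `&` O) h) h).
Proof.
move=> povmA povmB ssA ssB oO.
have mO : measurable (O : set (borelType Y)) by exact: sub_sigma_algebra.
have [r [r0 r1 rP]] := common_contraction_ratio sigma_contraction.
have [M M0 XM] := compact_mdist_lt cX.
pose e n := M * r ^+ n.
have mC n : measurable (inner_set X O (e n) : set (borelType Y)).
  exact: measurable_inner_set.
have mUC : measurable (\bigcup_n inner_set X O (e n) : set (borelType Y)).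
  exact: bigcup_measurable.
have e0 n : 0 < e n by rewrite mulr_gt0// exprn_gt0.
have ce : e n @[n --> \oo] --> (0 : R^o).
  rewrite -[X in _ --> X](mulr0 M).
  by apply: cvgMr; apply: cvg_expr; rewrite gtr0_norm.
have de : {homo e : m n / (m <= n)%N >-> n <= m}.
  by move=> m n mn; rewrite ler_pM2l// ler_wiXn2l// ltW.
have := nondecreasing_cvg_mu (mu := povm_measure mX povmA h) mC mUC
  (inner_set_nondecreasing X O de).
rewrite povm_measureE// bigcup_inner_set// => cA.
rewrite -lee_fin -(cvg_lim _ cA)//; apply: lime_le.
  by apply/cvg_ex; eexists; exact: cA.
apply: nearW => n; rewrite [X in (X <= _)%E]povm_measureE// lee_fin.
apply: (self_similar_le_gap h povmA povmB ssA ssB r0 rP XM (mC n) mO (n := n)).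
by move=> x y Xx Cx Xy; exact: Cx.
Qed.

(** Exchanging the two POVMs turns the inequality on open sets into an equality
    of the two measures on a generating pi-system; polarization then passes
    from the diagonal values to the operators. *)
Lemma self_similar_uniq (A B : set Y -> H -> H) (D : set Y) :
  is_povm ip X A -> is_povm ip X B -> self_similar A -> self_similar B ->
  borel_subset X D -> A D = B D.
Proof.
move=> povmA povmB ssA ssB bD; have [mD DX] := bD.
apply: (polarization (ip := ip)); [exact: (povm_bounded povmA bD).1|
  exact: (povm_bounded povmB bD).1|move=> h].
have : povm_measure mX povmA h D = povm_measure mX povmB h D.
  apply: (@measure_unique _ R (borelType Y) (@open Y) (fun=> setT)) => //.
  - exact: openI.
  - by move=> _; exact: openT.
  - by rewrite bigcup_const.
  - move=> O oO; have mO : measurable (O : set (borelType Y)).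
      exact: sub_sigma_algebra.
    rewrite !povm_measureE//; congr EFin; apply/le_anti/andP; split;
    exact: le_open.
  - by move=> _; exact: povm_measure_fin.
rewrite !povm_measureE// setIidr// => -[].
have := ger0_Im (povm_positive povmA bD h).
have := ger0_Im (povm_positive povmB bD h).
by case: (ip _ _) => a b /= ->; case: (ip _ _) => c d /= -> ->.
Qed.

End self_similar_povm.

(** * The Hutchinson measure is carried by the attractor *)

Section hutchinson_support.
Context (R : realType) (Y : completeMetricType R) (N : nat).
Variable sigma : 'I_N -> Y -> Y.
Hypothesis sigma_contraction : forall i, lipschitz_contraction (sigma i).
Context (X : set Y) (hX : is_attractor sigma X) (mu : probability (borelType Y) R).
Hypotheses (N_gt0 : (0 < N)%N) (hmu : is_hutchinson_measure sigma mu).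

Let fattening (e : R) : set (borelType Y) := \bigcup_(x in X) [set y | mdist x y < e].

Let open_fattening e : open (fattening e : set Y).
Proof.
apply: bigcup_open => x _; rewrite openE => y /= xy.
apply/nbhs_ballP; exists (e - mdist x y) => /=; first by rewrite subr_gt0.
by move=> z; rewrite ballEmdist /= => yz; have := metric_triangle x y z; lra.
Qed.

Let measurable_fattening e : measurable (fattening e).
Proof. exact: sub_sigma_algebra. Qed.

Let fattening_sub (a b : R) : a <= b -> fattening a `<=` fattening b.
Proof. by move=> ab y [x Xx /= xy]; exists x => //=; exact: lt_le_trans xy ab. Qed.

(** Invariance spreads the mass around [X]: the [e]-neighbourhood of [X] has
    at least the measure of its [e / r]-neighbourhood; iterating, that of the
    neighbourhoods of radius [e / r ^+ n], which exhaust the space. *)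
Let fattening_full e : 0 < e -> mu (fattening e) = 1%E.
Proof.
move=> e0; have [r [r0 r1 rP]] := common_contraction_ratio sigma_contraction.
have grow a : (mu (fattening (a / r)) <= mu (fattening a))%E.
  have N0 : (0 < N%:R%:E :> \bar R)%E by rewrite lte_fin ltr0n.
  have sumN (c : \bar R) : c \is a fin_num -> (N%:R%:E * c = \sum_(i < N) c)%E.
    by case: c => [c| |]// _; rewrite sumEFin sumr_const card_ord -[in RHS]mulr_natl.
  rewrite -(lee_pmul2l _ N0)// sumN ?fin_num_measure//.
  rewrite (hutchinson_sum hmu N_gt0 (measurable_fattening a)).
  apply: lee_sum => i _.
  apply: le_measure; rewrite ?inE//.
    exact: measurable_preimage_contraction.
  move=> y [x Xx /= xy]; exists (sigma i x); first exact: (attractor_sub i hX Xx).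
  by apply: le_lt_trans (rP i x y) _; rewrite mulrC -ltr_pdivlMr.
have growX n : (mu (fattening (e / r ^+ n)) <= mu (fattening e))%E.
  elim: n => [|n]; first by rewrite expr0 divr1.
  by apply: le_trans; rewrite exprSr invfM mulrA; exact: grow.
have nd : nondecreasing_seq (fun n => fattening (e / r ^+ n)).
  move=> m n mn; apply/subsetPset/fattening_sub.
  by rewrite ler_pM2l// lef_pV2 ?posrE ?exprn_gt0// ler_wiXn2l// ltW.
have cov : \bigcup_n fattening (e / r ^+ n) = setT.
  apply/seteqP; split=> // y _; case: (hX) => [[x0 Xx0] _ _].
  have : r ^+ n @[n --> \oo] --> (0 : R^o) by apply: cvg_expr; rewrite gtr0_norm.
  have d0 : 0 < e / (mdist x0 y + 1) by rewrite divr_gt0// ltr_wpDl ?mdist_ge0.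
  move=> /cvgrPdist_lt/(_ _ d0)[n _ /(_ n (leqnn n))] /=.
  rewrite sub0r normrN gtr0_norm ?exprn_gt0// => rn.
  exists n => //; exists x0 => //=; apply: (@lt_trans _ _ (mdist x0 y + 1)).
    by rewrite ltrDl.
  rewrite ltr_pdivlMr ?exprn_gt0// mulrC -ltr_pdivlMr//.
  by rewrite ltr_wpDl ?mdist_ge0.
apply/eqP; rewrite eq_le probability_le1//=.
rewrite -(@probability_setT _ _ _ mu) -cov.
have mf n : measurable (fattening (e / r ^+ n)) by [].
have cmu := nondecreasing_cvg_mu (mu := mu) mf (bigcup_measurable (fun n _ => mf n)) nd.
rewrite -(cvg_lim _ cmu)//; apply: lime_le; last by apply: nearW => n; exact: growX.
by apply/cvg_ex; eexists; exact: cmu.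
Qed.

(** [X] is closed, so it is the intersection of its neighbourhoods of radius
    [1 / (n + 1)], all of full measure. *)
Lemma hutchinson_attractor : mu X = 1%E.
Proof.
have [_ cX _] := hX.
have clX : closed X by apply: compact_closed => //; exact: metric_hausdorff.
have XE : \bigcap_n fattening n.+1%:R^-1 = X.
  apply/seteqP; split => [y yX|y Xy n _]; last first.
    by exists y => //=; rewrite mdistxx invr_gt0 ltr0n.
  apply: clX => B /nbhs_ballP[e /= e0 yB].
  have [n _ /(_ n (leqnn n))/= ne] := near_infty_natSinv_lt (PosNum e0).
  have [x Xx /= xy] := yX n Logic.I.
  exists x; split => //; apply: yB; rewrite ballEmdist /= metric_sym.
  exact: lt_trans xy ne.
have ni : nonincreasing_seq (fun n => fattening n.+1%:R^-1).
  move=> m n mn; apply/subsetPset/fattening_sub.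
  by rewrite lef_pV2 ?posrE ?ltr0n// ler_nat.
have mf n : measurable (fattening n.+1%:R^-1) by [].
have f0 : (mu (fattening 1%:R^-1) < +oo)%E.
  by rewrite (le_lt_trans (probability_le1 mu (mf 0%N)))// ltry.
have cmu := nonincreasing_cvg_mu (mu := mu) f0 mf (bigcapT_measurable mf) ni.
rewrite -[X in mu X]XE -(cvg_lim _ cmu)//.
rewrite (_ : mu \o _ = cst 1%E) ?lim_cst//; apply/funext => n /=.
by rewrite fattening_full// invr_gt0 ltr0n.
Qed.

End hutchinson_support.

(** * Transfer of densities along a nonsingular map *)

Section density.
Local Open Scope ereal_scope.
Context d (T : measurableType d) (R : realType).
Variables (mu : {finite_measure set T -> \bar R}) (k : T -> R).
Hypotheses (k_ge0 : forall x, (0 <= k x)%R)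
           (int_k : mu.-integrable setT (EFin \o k)).

Let mEk : measurable_fun setT (EFin \o k). Proof. exact: measurable_int int_k. Qed.

Definition with_density (B : set T) := \int[mu]_(x in B) (k x)%:E.

Let with_density0 : with_density set0 = 0.
Proof. exact: integral_set0. Qed.

Let with_density_ge0 B : 0 <= with_density B.
Proof. by apply: integral_ge0 => x _; rewrite lee_fin. Qed.

Let with_density_sigma_additive : semi_sigma_additive with_density.
Proof. by apply: semi_sigma_additive_nng_induced => // x; rewrite lee_fin. Qed.

HB.instance Definition _ := isMeasure.Build _ _ _ with_density
  with_density0 with_density_ge0 with_density_sigma_additive.

Let with_density_fin : fin_num_fun with_density.
Proof.
by move=> B mB; apply: integrable_fin_num => //; exact: integrableS int_k.
Qed.

HB.instance Definition _ := Measure_isFinite.Build _ _ _ with_density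
  with_density_fin.

Definition density_measure : {finite_measure set T -> \bar R} := with_density.

Lemma density_dominated : density_measure `<< mu.
Proof.
apply/null_content_dominatesP => B mB B0.
by apply: null_set_integral => //; exact: measurable_funTS.
Qed.

(** The Radon-Nikodym derivative of the measure [k mu] with respect to [mu] is
    [k] almost everywhere, so that the change of variables known for the
    derivative holds for [k]. *)
Lemma integral_density (g : T -> \bar R) : measurable_fun setT g ->
  (forall x, 0 <= g x) ->
  \int[density_measure]_x g x = \int[mu]_x (g x * (k x)%:E).
Proof.
move=> mg g0; have dom := density_dominated.
rewrite -(Radon_Nikodym_SigmaFinite.change_of_variables dom)//.
have ifd := Radon_Nikodym_SigmaFinite.f_integrable dom.
apply: ae_eq_integral => //.
- by apply: emeasurable_funM => //; exact: measurable_int ifd.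
- exact: emeasurable_funM.
- apply: ae_eqe_mul2l; apply: integral_ae_eq => // B _ mB.
  by rewrite -Radon_Nikodym_SigmaFinite.f_integral.
Qed.

End density.

Section transfer.
Local Open Scope ereal_scope.
Context d (T : measurableType d) (R : realType).
Variables (mu : {finite_measure set T -> \bar R}) (s : T -> T) (c : R).
Hypotheses (ms : measurable_fun setT s) (c_gt0 : (0 < c)%R).
Hypothesis s_le : forall g : T -> \bar R, measurable_fun setT g ->
  (forall x, 0 <= g x) -> \int[mu]_x g (s x) <= c%:E * \int[mu]_x g x.

(** The transfer operator of [s] on nonnegative functions: [w] is the derivative
    of the image under [s] of the measure [k mu], which is absolutely
    continuous because [s_le] makes preimages of null sets null. *)
Lemma transfer_density (k : T -> R) : (forall x, 0 <= k x)%R ->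
  mu.-integrable setT (EFin \o k) ->
  exists w : T -> R, [/\ measurable_fun setT w, (forall x, 0 <= w x)%R &
    forall g : T -> \bar R, measurable_fun setT g -> (forall x, 0 <= g x) ->
    \int[mu]_x (g (s x) * (k x)%:E) = \int[mu]_x (g x * (w x)%:E)].
Proof.
move=> k0 ik; have msB B : measurable B -> measurable (s @^-1` B).
  by move=> mB; rewrite -[X in measurable X]setTI; exact: ms.
pose m1 := density_measure k0 ik.
pose nu0 : {measure set T -> \bar R} :=
  measure_function_pushforward__canonical__measure_function_Measure m1 ms.
have nu_fin : fin_num_fun nu0.
  by move=> B mB; exact: (fin_num_measure m1 _ (msB _ mB)).
pose nu : {finite_measure set T -> \bar R} :=
  HB.pack (Measure.sort nu0) (Measure_isFinite.Build _ _ _ (Measure.sort nu0) nu_fin).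
have dom : nu `<< mu.
  apply/null_content_dominatesP => B mB B0.
  have sB0 : mu (s @^-1` B) = 0.
    apply/eqP; rewrite -measure_le0.
    have mE : measurable_fun setT (EFin \o \1_B : T -> \bar R).
      by apply/measurable_EFinP; exact: measurable_indic.
    have m0 : \int[mu]_x (\1_B x)%:E = 0 by rewrite integral_indic// setIT.
    have : \int[mu]_x (\1_B (s x))%:E <= 0.
      have := s_le mE; rewrite /= m0 mule0; apply.
      by move=> x; rewrite lee_fin.
    rewrite (_ : (fun x => _) = EFin \o \1_(s @^-1` B)); last first.
      by apply/funext => x /=; rewrite !indicE.
    by rewrite integral_indic ?setIT//; exact: msB.
  exact: (null_content_dominatesP _ _).1 (density_dominated k0 ik) _ (msB _ mB) sB0.
pose f := Radon_Nikodym_SigmaFinite.f nu mu.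
have f_fin x : (fine (f x))%:E = f x.
  by rewrite fineK// Radon_Nikodym_SigmaFinite.f_fin_num.
exists (fine \o f); split.
- apply: measurableT_comp => //.
  exact: measurable_int (Radon_Nikodym_SigmaFinite.f_integrable dom).
- by move=> x /=; apply: fine_ge0; exact: Radon_Nikodym_SigmaFinite.f_ge0.
move=> g mg g0; have mgs : measurable_fun setT (g \o s) by exact: measurableT_comp.
rewrite -(integral_density k0 ik mgs (fun x => g0 (s x))).
under [RHS]eq_integral do rewrite f_fin.
rewrite (Radon_Nikodym_SigmaFinite.change_of_variables dom)//.
by rewrite [RHS](ge0_integral_pushforward ms m1 measurableT mg).
Qed.

(** Testing the duality against the truncation [v = min(w, n)], which is
    bounded, gives
    [\int v^2 <= \int v w = \int (v \o s) k
      <= (\int (v \o s)^2 / c + c \int k^2) / 2 <= (\int v^2 + c \int k^2) / 2],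
    hence [\int v^2 <= c \int k^2] for all [n]. *)
Lemma transfer_density_sq (k w : T -> R) : (forall x, 0 <= k x)%R ->
  mu.-integrable setT (EFin \o k) ->
  mu.-integrable setT (fun x => (k x ^+ 2)%:E) ->
  measurable_fun setT w -> (forall x, 0 <= w x)%R ->
  (forall g : T -> \bar R, measurable_fun setT g -> (forall x, 0 <= g x) ->
    \int[mu]_x (g (s x) * (k x)%:E) = \int[mu]_x (g x * (w x)%:E)) ->
  mu.-integrable setT (fun x => (w x ^+ 2)%:E).
Proof.
move=> k0 ik ik2 mw w0 dual.
pose v (n : nat) x := Num.min (w x) n%:R.
have v0 n x : (0 <= v n x)%R by rewrite le_min w0 ler0n.
have mv n : measurable_fun setT (v n) by exact: measurable_minr.
have mv2 n : measurable_fun setT (fun x => (v n x ^+ 2)%:E).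
  by apply/measurable_EFinP; exact: measurable_funX.
have mk : measurable_fun setT k by apply/measurable_EFinP; exact: measurable_int ik.
have mk2 : measurable_fun setT (fun x => (k x ^+ 2)%:E) by exact: measurable_int ik2.
pose K := \int[mu]_x (k x ^+ 2)%:E.
have K_fin : K \is a fin_num by exact: integrable_fin_num.
have v_fin n : \int[mu]_x (v n x ^+ 2)%:E \is a fin_num.
  rewrite ge0_fin_numE ?integral_ge0// => [|x _]; last by rewrite lee_fin sqr_ge0.
  apply: (@le_lt_trans _ _ (\int[mu]_x (n%:R ^+ 2 : R)%:E)).
    apply: ge0_le_integral => // x _; rewrite ?lee_fin ?sqr_ge0//.
    by rewrite lerXn2r ?nnegrE// ge_min lexx orbT.
  rewrite integral_cst// lte_mul_pinfty// ?lee_fin ?sqr_ge0//.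
  by rewrite -ge0_fin_numE// fin_num_measure.
have bound n : \int[mu]_x (v n x ^+ 2)%:E <= c%:E * K.
  have mvE : measurable_fun setT (EFin \o v n) by exact/measurable_EFinP.
  have lo : \int[mu]_x (v n x ^+ 2)%:E <= \int[mu]_x ((v n x)%:E * (w x)%:E).
    apply: ge0_le_integral => //.
    - by move=> x _; rewrite lee_fin sqr_ge0.
    - by apply: emeasurable_funM => //; exact/measurable_EFinP.
    - move=> x _; rewrite -EFinM lee_fin expr2 ler_wpM2l//.
      by rewrite ge_min lexx.
  have mvs : measurable_fun setT (fun x => (v n (s x) ^+ 2)%:E).
    exact: (measurableT_comp (mv2 n) ms).
  have hi : \int[mu]_x ((v n (s x))%:E * (k x)%:E) <=
      \int[mu]_x ((2^-1 * c^-1)%:E * (v n (s x) ^+ 2)%:E +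
                  (2^-1 * c)%:E * (k x ^+ 2)%:E).
    apply: ge0_le_integral => //.
    - by move=> x _; rewrite -EFinM lee_fin mulr_ge0.
    - apply: emeasurable_funM => //; last exact/measurable_EFinP.
      exact: (measurableT_comp mvE ms).
    - by apply: emeasurable_funD; exact: measurable_funeM.
    - move=> x _; rewrite -!EFinM -EFinD lee_fin.
      (* The weight [c] is the one that [s_le] cancels afterwards. *)
      rewrite -subr_ge0 (_ : _ - _ = (2^-1 * c^-1) * (v n (s x) - c * k x) ^+ 2)%R.
        by rewrite mulr_ge0 ?sqr_ge0// mulr_ge0// invr_ge0 ltW.
      by field; rewrite gt_eqF.
  have := le_trans lo; rewrite -dual// => [/(_ _ hi)|x]; last by rewrite lee_fin.
  rewrite ge0_integralD//; last 4 first.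
  - by move=> x _; rewrite -EFinM lee_fin mulr_ge0 ?sqr_ge0// mulr_ge0// invr_ge0 ltW.
  - exact: measurable_funeM.
  - by move=> x _; rewrite -EFinM lee_fin mulr_ge0 ?sqr_ge0// mulr_ge0// ltW.
  - exact: measurable_funeM.
  rewrite !ge0_integralZl//; try by
    [move=> x _; rewrite lee_fin sqr_ge0 | rewrite lee_fin mulr_ge0// ?invr_ge0 ltW].
  have := s_le (mv2 n); rewrite -/K.
  have /[swap] /[apply] : forall x, 0 <= (v n x ^+ 2)%:E.
    by move=> x; rewrite lee_fin sqr_ge0.
  rewrite -(fineK (v_fin n)) -(fineK K_fin) => sle.
  have : \int[mu]_x (v n (s x) ^+ 2)%:E \is a fin_num.
    rewrite ge0_fin_numE ?integral_ge0// => [|x _]; last by rewrite lee_fin sqr_ge0.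
    by apply: le_lt_trans sle _; rewrite -EFinM ltry.
  move=> /fineK e; move: sle; rewrite -e -!EFinM -EFinD !lee_fin.
  set b := fine _; set a := fine _; set q := fine _ => ba aq.
  have : (c^-1 * b <= a)%R by rewrite mulrC ler_pdivrMr// [leRHS]mulrC.
  by rewrite -mulrA in aq *; lra.
apply/integrableP; split; first by apply/measurable_EFinP; exact: measurable_funX.
under eq_integral do rewrite gee0_abs ?lee_fin ?sqr_ge0//.
have cv x : (v n x ^+ 2)%:E @[n --> \oo] --> (w x ^+ 2)%:E.
  apply: cvg_near_cst; near=> n; rewrite /v min_l//.
  by near: n; exact: nbhs_infty_ger.
have -> : \int[mu]_x (w x ^+ 2)%:E = limn (fun n => \int[mu]_x (v n x ^+ 2)%:E).
  rewrite -monotone_convergence//.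
  - by apply: eq_integral => x _; apply/esym/cvg_lim => //; exact: cv.
  - by move=> n x _; rewrite lee_fin sqr_ge0.
  - move=> x _ m n mn; rewrite lee_fin lerXn2r ?nnegrE//.
    by rewrite le_min !ge_min lexx /= ler_nat mn orbT.
apply: (@le_lt_trans _ _ (c%:E * K)).
  apply: lime_le; last by apply: nearW => n; exact: bound.
  apply: ereal_nondecreasing_is_cvgn => m n mn; apply: ge0_le_integral => //.
  - by move=> x _; rewrite lee_fin sqr_ge0.
  - move=> x _; rewrite lee_fin lerXn2r ?nnegrE//.
    by rewrite le_min !ge_min lexx /= ler_nat mn orbT.
by rewrite -(fineK K_fin) -EFinM ltry.
Unshelve. all: by end_near. Qed.

(** The positive and negative parts of [q] can be treated separately because
    [k] and [w] are nonnegative. *)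
Lemma transfer_density_signed (k w q : T -> R) : (forall x, 0 <= k x)%R ->
  (forall x, 0 <= w x)%R -> measurable_fun setT q ->
  (forall g : T -> \bar R, measurable_fun setT g -> (forall x, 0 <= g x) ->
    \int[mu]_x (g (s x) * (k x)%:E) = \int[mu]_x (g x * (w x)%:E)) ->
  \int[mu]_x (q (s x) * k x)%:E = \int[mu]_x (q x * w x)%:E.
Proof.
move=> k0 w0 mq dual.
have mqE : measurable_fun setT (EFin \o q) by exact/measurable_EFinP.
have dualp := dual _ (measurable_funepos mqE) (funepos_ge0 _).
have dualn := dual _ (measurable_funeneg mqE) (funeneg_ge0 _).
rewrite [LHS]integralE [RHS]integralE.
have pos (t : T -> T) (b : T -> R) : (forall x, 0 <= b x)%R ->
    (fun x => (q (t x) * b x)%:E)^\+ = (fun x => (EFin \o q)^\+ (t x) * (b x)%:E).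
  move=> b0; apply/funext => x; rewrite !funeposE /= -!EFin_max -EFinM.
  by rewrite maxr_pMl// mul0r.
have neg (t : T -> T) (b : T -> R) : (forall x, 0 <= b x)%R ->
    (fun x => (q (t x) * b x)%:E)^\- = (fun x => (EFin \o q)^\- (t x) * (b x)%:E).
  move=> b0; apply/funext => x; rewrite !funenegE /= -!EFin_max -EFinM.
  by rewrite maxr_pMl// mul0r mulNr.
by rewrite (pos s k k0) (neg s k k0) (pos id w w0) (neg id w w0) dualp dualn.
Qed.

End transfer.

(** * Multiplication by indicator functions on L2 *)

Section L2_multiplication.
Local Open Scope quotient_scope.
Local Open Scope complex_scope.
Context d (T : measurableType d) (R : realType).
Context (mu : {measure set T -> \bar R}) (D : set T) (mD : measurable D).
Local Notation Re := complex.Re.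
Local Notation Im := complex.Im.
Local Notation ip := (L2_ip mu mD).
Local Notation sqintD := (sqint mu mD).

Lemma L2_class_linear (a : R[i]) f g : f \in sqintD -> g \in sqintD ->
  L2_class mu mD (a *: f + g) = a *: L2_class mu mD f + L2_class mu mD g.
Proof.
move=> fL gL; rewrite /L2_class -piZ -piD; congr (\pi_(L2 mu mD) _).
apply: val_inj; rewrite /= !insubdK//.
by apply: (rpredD (S := sqintD)) => //; exact: sqintZ.
Qed.

Lemma L2_ip_class f g : f \in sqintD -> g \in sqintD ->
  ip (L2_class mu mD f) (L2_class mu mD g) = L2fun_ip mu D f g.
Proof. by move=> fL gL; rewrite L2_ipE !insubdK. Qed.

Lemma repr_sqint (u : L2 mu mD) : (repr u : T -> R[i]^o) \in sqintD.
Proof. exact: valP. Qed.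

Definition restrict_fun (B : set T) (f : T -> R[i]^o) : T -> R[i]^o :=
  fun x => (\1_B x)%:C * f x.

Lemma sqint_restrict B f : measurable B -> f \in sqintD ->
  restrict_fun B f \in sqintD.
Proof.
move=> mB /sqintP[mf f2]; have mg : cmeas D (restrict_fun B f).
  apply: cmeasM => //; split; last exact: measurable_cst.
  by apply: measurable_funTS; exact: measurable_indic.
apply/sqintP; split => //; apply: le_integrable f2 => //.
  by apply/measurable_EFinP; exact: cmeas_sqmod.
move=> x _; rewrite /= lee_fin !ger0_norm ?sqmod_ge0// sqmodM.
rewrite ler_piMl ?sqmod_ge0// /sqmod /= expr0n addr0 indicE.
by case: (x \in B); rewrite ?expr1n ?expr0n.
Qed.

Definition restrict_op (B : set T) (u : L2 mu mD) : L2 mu mD :=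
  L2_class mu mD (restrict_fun B (repr u)).

Lemma restrict_opE B f : measurable B -> f \in sqintD ->
  restrict_op B (L2_class mu mD f) = L2_class mu mD (restrict_fun B f).
Proof.
move=> mB fL; apply/eq_L2_class; rewrite ?sqint_restrict ?repr_sqint//.
have := repr_L2_class fL; apply: filterS => x /= fx Dx.
by rewrite /restrict_fun fx.
Qed.

Lemma linear_restrict_op B : measurable B -> linear (restrict_op B).
Proof.
move=> mB a u v; rewrite -[in LHS](L2_class_repr u) -[in LHS](L2_class_repr v).
rewrite -L2_class_linear ?repr_sqint// restrict_opE//; last first.
  by apply: (rpredD (S := sqintD)); [apply: sqintZ|]; exact: repr_sqint.
rewrite -L2_class_linear ?sqint_restrict ?repr_sqint//; congr L2_class.
by apply/funext => x; rewrite /restrict_fun !fctE /= mulrDr [in LHS]mulrCA.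
Qed.

(** An indicator is real and idempotent, so multiplication by it is an
    orthogonal projection; positivity and boundedness both follow from this. *)
Lemma ip_restrict_op B u v : measurable B ->
  ip (restrict_op B u) v = ip (restrict_op B u) (restrict_op B v).
Proof.
move=> mB; rewrite -[in LHS](L2_class_repr v).
rewrite !L2_ip_class ?sqint_restrict ?repr_sqint//.
congr cint; apply/funext => x; rewrite /restrict_fun indicE.
by case: (x \in B); rewrite ?mul0r// !mul1r.
Qed.

Lemma positive_restrict_op B : measurable B -> positive_operator ip (restrict_op B).
Proof.
move=> mB u; suff : 0 <= ip (restrict_op B u) u by [].
by rewrite ip_restrict_op//; exact: ip_ge0.
Qed.

Lemma bounded_restrict_op B : measurable B -> bounded_operator ip (restrict_op B).
Proof.
move=> mB; apply: bounded_of_contraction; first exact: linear_restrict_op.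
move=> u; have : Re (ip (restrict_op B u) u) <=
    (Re (ip (restrict_op B u) (restrict_op B u)) + Re (ip u u)) / 2.
  exact: Re_ip_le.
by rewrite ip_restrict_op//= => ?; lra.
Qed.

Lemma restrict_op_id : restrict_op D = id.
Proof.
apply/funext => u; rewrite -[RHS]L2_class_repr.
apply/eq_L2_class; rewrite ?sqint_restrict ?repr_sqint//.
by apply: aeW => x Dx; rewrite /restrict_fun indicE mem_set// mul1r.
Qed.

Lemma restrict_op0 : restrict_op set0 = (fun=> 0).
Proof.
apply/funext => u; rewrite /restrict_op (_ : restrict_fun _ _ = 0); last first.
  by apply/funext => x; rewrite /restrict_fun indic0 mul0r.
rewrite /L2_class (_ : insubd _ _ = 0)//.
by apply: val_inj; rewrite insubdK// sqint0.
Qed.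

(** The indefinite integral of an integrable function is a charge, hence
    countably additive. *)
Let cvg_sum_Rintegral (phi : T -> R) (B : nat -> set T) :
  mu.-integrable D (EFin \o phi) -> (forall n, measurable (B n)) ->
  trivIset setT B ->
  (\sum_(0 <= k < n) (\int[mu]_(x in D) (\1_(B k) x * phi x))%R : R^o)
    @[n --> \oo] --> ((\int[mu]_(x in D) (\1_(\bigcup_n B n) x * phi x))%R : R^o).
Proof.
move=> iphi mB tB.
have iphiD : mu.-integrable setT ((EFin \o phi) \_ D).
  by apply/(integrable_mkcond _ mD).
have RE (C : set T) : measurable C ->
    (\int[mu]_(x in D) (\1_C x * phi x))%R = fine (induced_charge iphiD C).
  move=> mC; rewrite /Rintegral /induced_charge; congr fine.
  rewrite [RHS]integral_mkcond [LHS]integral_mkcond.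
  apply: eq_integral => x _; rewrite !patchE indicE.
  by case: (x \in D); case: (x \in C); rewrite ?mul1r ?mul0r.
have mUB : measurable (\bigcup_n B n) by exact: bigcup_measurable.
under eq_fun do under eq_bigr do rewrite RE//.
rewrite RE//.
pose nu : {charge set T -> \bar R} := induced_charge iphiD.
have nuB := charge_semi_sigma_additive (s := nu) _ mB tB mUB.
have nuU : nu (\bigcup_n B n) \is a fin_num by exact: fin_num_measure.
have sumE n : fine (\sum_(0 <= k < n) nu (B k))%E = \sum_(0 <= k < n) fine (nu (B k)).
  by rewrite -sum_fine// => k _; exact: fin_num_measure.
rewrite (_ : (fun n => _) = fine \o (fun n => (\sum_(0 <= k < n) nu (B k))%E)).
  by apply: fine_cvg; rewrite fineK.
by apply/funext => n /=; rewrite sumE.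
Qed.

Lemma cvg_sum_restrict_op (B : nat -> set T) u v :
  (forall n, measurable (B n)) -> trivIset setT B ->
  (fun n => \sum_(0 <= k < n) ip (restrict_op (B k) u) v : R[i]^o)
    @ \oo --> (ip (restrict_op (\bigcup_n B n) u) v : R[i]^o).
Proof.
move=> mB tB.
have [i1 i2] := cintegrableM mD (L2fun_sq_integrable (repr u)) (L2fun_sq_integrable (repr v)).
pose phi x := repr u x * (repr v x)^*.
have ipE (C : set T) : measurable C -> ip (restrict_op C u) v =
    (\int[mu]_(x in D) (\1_C x * Re (phi x)))%R +i*
    (\int[mu]_(x in D) (\1_C x * Im (phi x)))%R.
  move=> mC; rewrite -[v in LHS]L2_class_repr.
  rewrite L2_ip_class ?sqint_restrict ?repr_sqint// /L2fun_ip /cint.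
  congr (_ +i* _); apply: eq_Rintegral => x _; rewrite /restrict_fun -mulrA.
    by rewrite Defs.ReM /= mul0r subr0.
  by rewrite Defs.ImM /= mul0r addr0.
have mUB : measurable (\bigcup_n B n) by exact: bigcup_measurable.
rewrite ipE//; apply: cvg_complex => /=.
  rewrite (_ : (fun n => _) = fun n =>
      \sum_(0 <= k < n) (\int[mu]_(x in D) (\1_(B k) x * Re (phi x)))%R).
    exact: cvg_sum_Rintegral.
  by apply/funext => n; rewrite raddf_sum; apply: eq_bigr => k _; rewrite [in LHS]ipE.
rewrite (_ : (fun n => _) = fun n =>
    \sum_(0 <= k < n) (\int[mu]_(x in D) (\1_(B k) x * Im (phi x)))%R).
  exact: cvg_sum_Rintegral.
by apply/funext => n; rewrite raddf_sum; apply: eq_bigr => k _; rewrite [in LHS]ipE.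
Qed.

End L2_multiplication.

(** * Composition operators of an iterated function system *)

Section composition_operators.
Local Open Scope quotient_scope.
Local Open Scope complex_scope.
Context (R : realType) (Y : completeMetricType R) (N : nat).
Variable sigma : 'I_N -> Y -> Y.
Hypothesis sigma_contraction : forall i, lipschitz_contraction (sigma i).
Context (X : set Y) (hX : is_attractor sigma X) (mu : probability (borelType Y) R).
Hypotheses (N_gt0 : (0 < N)%N) (hmu : is_hutchinson_measure sigma mu).
Local Notation Re := complex.Re.
Local Notation Im := complex.Im.
Local Notation mX := (attractor_measurable hX).
Local Notation ip := (L2_ip mu mX).
Local Notation F := (comp_op hX mu).
Local Notation c := ((Num.sqrt N%:R)^-1 : R).
Local Notation pull i f := (fun x : borelType Y => c%:C * f (sigma i x) : R[i]^o).

Let msigma i : measurable_fun setT (sigma i : borelType Y -> borelType Y).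
Proof. exact: contraction_measurable. Qed.
Arguments msigma : clear implicits.

(** The invariance of [mu], integrated: the measures [N mu] and the sum of the
    images of [mu] under the [sigma i] coincide. *)
Lemma hutchinson_integral (g : borelType Y -> \bar R) :
  measurable_fun setT g -> (forall y, 0 <= g y)%E ->
  (\sum_(i < N) \int[mu]_y g (sigma i y) = N%:R%:E * \int[mu]_y g y)%E.
Proof.
move=> mg g0; pose i0 := Ordinal N_gt0.
pose m (k : nat) : {measure set (borelType Y) -> \bar R} :=
  measure_function_pushforward__canonical__measure_function_Measure mu
    (msigma (insubd i0 k)).
rewrite -[RHS](ge0_integral_mscale mu measurableT (NngNum (ler0n R N)))//.
transitivity (\int[msum m N]_y g y)%E; last first.
  apply: eq_measure_integral => A mA _; apply/esym.
  apply: (etrans (hutchinson_sum hmu N_gt0 mA)).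
  by apply: eq_bigr => k _; rewrite /m /pushforward /= valKd.
rewrite ge0_integral_measure_sum//; apply: eq_bigr => i _.
by rewrite /m (ge0_integral_pushforward (msigma _) mu measurableT mg)//= valKd.
Qed.

Lemma integral_attractor (g : borelType Y -> \bar R) :
  measurable_fun setT g -> (forall y, 0 <= g y)%E ->
  (\int[mu]_y g y = \int[mu]_(y in X) g y)%E.
Proof.
move=> mg g0; have mXC := measurableC mX.
rewrite (@ge0_negligible_integral _ _ _ mu setT (~` X))//.
  by rewrite setDE setTI setCK.
rewrite -[~` X]setTD (measureD measurableT mX)//= ?setTI; last by rewrite /= probability_setT ltry.
rewrite probability_setT (hutchinson_attractor sigma_contraction hX N_gt0 hmu).
by rewrite subee.
Qed.

Lemma sqint_pull i (f : borelType Y -> R[i]^o) :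
  f \in sqint mu mX -> pull i f \in sqint mu mX.
Proof.
by move=> fL; exact: (comp_sq_integrable sigma_contraction hmu i (MkL2fun fL)).
Qed.

Lemma comp_op_class i (f : borelType Y -> R[i]^o) : f \in sqint mu mX ->
  F i (L2_class mu mX f) = L2_class mu mX (pull i f).
Proof. by move=> fL; rewrite comp_opE// insubdK. Qed.

Lemma linear_comp_op i : linear (F i).
Proof.
move=> a u v; rewrite -[in LHS](L2_class_repr u) -[in LHS](L2_class_repr v).
rewrite -L2_class_linear ?repr_sqint// comp_op_class; last first.
  by apply: (rpredD (S := sqint mu mX)); [apply: sqintZ|]; exact: repr_sqint.
rewrite -L2_class_linear; try by apply: sqint_pull; exact: repr_sqint.
by congr L2_class; apply/funext => x; rewrite !fctE /= mulrDr [in LHS]mulrCA.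
Qed.

Lemma sq_norm_class (f : borelType Y -> R[i]^o) : f \in sqint mu mX ->
  ((Re (ip (L2_class mu mX f) (L2_class mu mX f)))%:E =
   \int[mu]_(x in X) (sqmod (f x))%:E)%E.
Proof.
move=> fL; have /sqintP[mf f2] := fL.
rewrite L2_ip_class//= /Rintegral.
rewrite (eq_integral (fun x => (sqmod (f x))%:E)) => [|x _]; last first.
  by congr EFin; rewrite /sqmod; case: (f x) => a b /=; ring.
by rewrite fineK//; exact: (integrable_fin_num mX f2).
Qed.

(** The isometry [\sum_i F_i^* F_i = id] on the diagonal. Integrals over [X] and
    over the whole space agree because [X] has full measure; this is where the
    part of [sigma i @^-1` X] outside [X] is seen to be negligible. *)
Lemma sq_norm_comp_op u :
  \sum_(i < N) Re (ip (F i u) (F i u)) = Re (ip u u).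
Proof.
have uL := repr_sqint u; have /sqintP[mu_ u2] := uL.
apply: EFin_inj; rewrite -sumEFin -[in RHS](L2_class_repr u) sq_norm_class//.
pose g : borelType Y -> \bar R := (fun x => (sqmod (repr u x))%:E) \_ X.
have g0 y : (0 <= g y)%E.
  by rewrite /g patchE; case: ifPn => // _; rewrite lee_fin sqmod_ge0.
have mg : measurable_fun setT g.
  by apply/(measurable_restrictT _ mX); exact: measurable_int u2.
have gE : (\int[mu]_y g y = \int[mu]_(x in X) (sqmod (repr u x))%:E)%E.
  by rewrite [RHS]integral_mkcond.
rewrite -gE.
have N0 : N%:R != 0 :> R by rewrite pnatr_eq0 -lt0n.
have -> : (\int[mu]_y g y = (N%:R^-1)%:E * (N%:R%:E * \int[mu]_y g y))%E.
  by rewrite muleA -EFinM mulVf// mul1e.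
rewrite -hutchinson_integral// ge0_sume_distrr; last first.
  by move=> i _; exact: integral_ge0.
apply: eq_bigr => i _; rewrite sq_norm_class ?sqint_pull//.
have mgs := measurableT_comp mg (msigma i).
rewrite [in RHS](integral_attractor mgs)//=.
rewrite -ge0_integralZl//; last 2 first.
- exact: mX.
- exact: measurable_funTS mgs.
apply: eq_integral => x /set_mem Xx; rewrite /g patchE mem_set; last first.
  exact: (attractor_sub i hX Xx).
rewrite sqmodM -EFinM; congr (_ * _)%:E.
by rewrite /sqmod /= expr0n addr0 exprVn sqr_sqrtr.
Qed.

Lemma contraction_comp_op i u : Re (ip (F i u) (F i u)) <= Re (ip u u).
Proof.
rewrite -(sq_norm_comp_op u) (bigD1 i)// lerDl sumr_ge0// => j _.
exact: (Re_ip_ge0 ip).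
Qed.

Lemma bounded_comp_op i : bounded_operator ip (F i).
Proof.
by apply: bounded_of_contraction; [exact: linear_comp_op|exact: contraction_comp_op].
Qed.

Lemma real_sqint (p : borelType Y -> R) :
  measurable_fun (X : set (borelType Y)) p ->
  mu.-integrable X (fun x => (p x ^+ 2)%:E) ->
  (fun x => (p x)%:C : R[i]^o) \in sqint mu mX.
Proof.
move=> mp p2; apply/sqintP; split; first by split => //; exact: measurable_cst.
rewrite (_ : (fun _ => _) = (fun x => (p x ^+ 2)%:E))//.
by apply/funext => x; rewrite /sqmod /= expr0n addr0.
Qed.

(** The adjoint image of a nonnegative function is its transfer density along
    [sigma i]. *)
Let nonneg_image i (p : borelType Y -> R) : (forall x, 0 <= p x) ->
  measurable_fun (X : set (borelType Y)) p ->
  mu.-integrable X (fun x => (p x ^+ 2)%:E) ->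
  exists w, forall u, ip (F i u) (L2_class mu mX (fun x => (p x)%:C)) = ip u w.
Proof.
move=> p0 mp p2.
(* The factor [N^(-1/2)] of [F i] is carried by the density. *)
pose k : borelType Y -> R := fun x => c * (p \_ X) x.
have c0 : 0 < c by rewrite invr_gt0 sqrtr_gt0 ltr0n.
have k0 x : 0 <= k x.
  by rewrite /k mulr_ge0 ?(ltW c0)// patchE; case: ifPn.
have mpX : measurable_fun setT (p \_ X : borelType Y -> R) by apply/(measurable_restrictT _ mX).
have mk : measurable_fun setT k by exact: measurable_funM.
have k2 : mu.-integrable setT (fun x => (k x ^+ 2)%:E).
  rewrite (_ : (fun x => _) = (fun x => (c ^+ 2)%:E * ((fun x => (p x ^+ 2)%:E) \_ X) x)%E).
    by apply: integrableZl => //; apply/(integrable_mkcond _ mX).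
  apply/funext => x; rewrite /k !patchE exprMn EFinM; congr (_ * _)%E.
  by case: ifPn => // _; rewrite expr0n.
have k1 : mu.-integrable setT (EFin \o k).
  apply: (@le_integrable _ _ _ mu setT measurableT _ (fun x => (1 + k x ^+ 2)%:E)).
  - exact/measurable_EFinP.
  (* [k <= 1 + k^2], and constants are integrable. *)
  - move=> x _; rewrite /= lee_fin !ger0_norm ?addr_ge0 ?sqr_ge0//.
    by have := sqr_ge0 (k x - 1); have := k0 x; nra.
  - under eq_fun do rewrite EFinD; apply: integrableD => //.
    by apply: finite_measure_integrable_cst.
have NR0 : 0 < N%:R :> R by rewrite ltr0n.
have sle (g : borelType Y -> \bar R) := hutchinson_integral_le sigma_contraction hmu (g := g) i.
have [w [mw w0 dual]] := transfer_density (msigma i) sle k0 k1.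
have w2 := transfer_density_sq (msigma i) NR0 sle k0 k1 k2 mw w0 dual.
have dualX (q : borelType Y -> R) : measurable_fun (X : set (borelType Y)) q ->
    \int[mu]_(x in X) (q (sigma i x) * k x) = \int[mu]_(x in X) (q x * w x).
  move=> mq; rewrite /Rintegral; congr fine.
  have mqX : measurable_fun setT (q \_ X : borelType Y -> R) by apply/(measurable_restrictT _ mX).
  have := transfer_density_signed k0 w0 mqX dual.
  rewrite [X in _ -> X = _]integral_mkcond [X in _ -> _ = X]integral_mkcond => e.
  transitivity (\int[mu]_x ((q \_ X) (sigma i x) * k x)%:E)%E.
    apply: eq_integral => x _; rewrite /k !patchE.
    case: (boolP (x \in X)) => [/set_mem Xx|_]; last by rewrite !mulr0.
    by rewrite mem_set//; exact: (attractor_sub i hX Xx).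
  rewrite e; apply: eq_integral => x _; rewrite !patchE.
  by case: ifPn => // _; rewrite mul0r.
have cE x : X x -> k x = c * p x by move=> Xx; rewrite /k patchE mem_set.
have pL := real_sqint mp p2.
have wL : (fun x => (w x)%:C : R[i]^o) \in sqint mu mX.
  apply: real_sqint; first exact: measurable_funTS.
  exact: (integrableS measurableT mX (@subsetT _ _) w2).
exists (L2_class mu mX (fun x => (w x)%:C)) => u.
have /sqintP[[mRe mIm] _] := repr_sqint u.
rewrite -[u]L2_class_repr comp_op_class ?repr_sqint//.
rewrite !L2_ip_class ?sqint_pull ?repr_sqint// /L2fun_ip /cint.
congr (_ +i* _).
  transitivity (\int[mu]_(x in X) (Re (repr u x) * w x)); last first.
    by apply: eq_Rintegral => x _; case: (repr u x) => a b /=; ring.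
  rewrite -(dualX _ mRe); apply: eq_Rintegral => x /set_mem Xx; rewrite cE//.
  by case: (repr u (sigma i x)) => a b /=; ring.
transitivity (\int[mu]_(x in X) (Im (repr u x) * w x)); last first.
  by apply: eq_Rintegral => x _; case: (repr u x) => a b /=; ring.
rewrite -(dualX _ mIm); apply: eq_Rintegral => x /set_mem Xx; rewrite cE//.
by case: (repr u (sigma i x)) => a b /=; ring.
Qed.

(** The vectors that have an adjoint image form a subspace, which contains the
    nonnegative functions, hence all of [L^2]. *)
Lemma comp_op_weak_adjoint i v : exists w, forall u, ip (F i u) v = ip u w.
Proof.
pose P v := exists w, forall u, ip (F i u) v = ip u w.
have P_lin (a : R[i]) v1 v2 : P v1 -> P v2 -> P (a *: v1 + v2).
  move=> [w1 h1] [w2 h2]; exists (a *: w1 + w2) => u.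
  by rewrite !linearDr !linearZr_LR /= h1 h2.
have P_real (t : borelType Y -> R) : measurable_fun (X : set (borelType Y)) t ->
    mu.-integrable X (fun x => (t x ^+ 2)%:E) ->
    P (L2_class mu mX (fun x => (t x)%:C)).
  move=> mt t2.
  have part (b : R) : b ^+ 2 = 1 -> let q x := Num.max (b * t x) 0 in
      [/\ forall x, 0 <= q x, measurable_fun (X : set (borelType Y)) q &
          mu.-integrable X (fun x => (q x ^+ 2)%:E)].
    move=> b2 q.
    have mq : measurable_fun (X : set (borelType Y)) q.
      by apply: measurable_maxr => //; exact: measurable_funM.
    split => //; first by move=> x; rewrite le_max lexx orbT.
    apply: le_integrable t2 => //; first exact: mX.
      by apply/measurable_EFinP; exact: measurable_funX.
    move=> x _; rewrite /= lee_fin !ger0_norm ?sqr_ge0// -[leRHS]mul1r -b2 -exprMn.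
    by rewrite /q; case: (leP (b * t x) 0) => _; rewrite ?expr0n ?sqr_ge0.
  have [p0 mp p2] := part 1 (expr1n _ _).
  have [n0 mn n2] := part (-1) (etrans (sqrrN 1) (expr1n _ _)).
  rewrite (_ : (fun x => _) = (-1 : R[i]) *: (fun x => (Num.max (-1 * t x) 0)%:C) +
                             (fun x => (Num.max (1 * t x) 0)%:C : R[i]^o)).
    rewrite L2_class_linear ?real_sqint//.
    by apply: P_lin; exact: nonneg_image.
  have tE x : t x = Num.max (1 * t x) 0 - Num.max (-1 * t x) 0.
    rewrite mulN1r mul1r; have [t0|/ltW t0] := leP 0 (t x).
      by rewrite [X in _ - X]max_r ?oppr_le0// subr0.
    by rewrite [X in _ - X]max_l ?oppr_ge0// sub0r opprK.
  apply/funext => x; rewrite !fctE -[_ *: _]/(_ * _).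
  apply/eqP; rewrite eq_complex /=; apply/andP; split; apply/eqP; last by ring.
  by rewrite [LHS]tE; ring.
have /sqintP[[mRe mIm] v2] := repr_sqint v.
have sq_part (t : borelType Y -> R) : measurable_fun (X : set (borelType Y)) t ->
    (forall x, t x ^+ 2 <= sqmod (repr v x)) ->
    mu.-integrable X (fun x => (t x ^+ 2)%:E).
  move=> mt tv; apply: le_integrable v2 => //; first exact: mX.
    by apply/measurable_EFinP; exact: measurable_funX.
  by move=> x _; rewrite /= lee_fin !ger0_norm ?sqr_ge0 ?sqmod_ge0.
have iRe : mu.-integrable X (fun x => (Re (repr v x) ^+ 2)%:E).
  by apply: sq_part => // x; rewrite lerDl sqr_ge0.
have iIm : mu.-integrable X (fun x => (Im (repr v x) ^+ 2)%:E).
  by apply: sq_part => // x; rewrite lerDr sqr_ge0.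
have -> : v = (0 +i* 1 : R[i]) *: L2_class mu mX (fun x => (Im (repr v x))%:C) +
              L2_class mu mX (fun x => (Re (repr v x))%:C).
  rewrite -L2_class_linear ?real_sqint// -[LHS]L2_class_repr; congr L2_class.
  apply/funext => x; rewrite !fctE -[_ *: _]/(_ * _).
  by case: (repr v x) => a b /=; congr (_ +i* _) => /=; ring.
by apply: P_lin; exact: P_real.
Qed.

(** [1_D (sigma i x) = 1_(sigma i @^-1` D) x]: composition intertwines the two
    multiplication operators. *)
Lemma comp_op_restrict i (D : set (borelType Y)) u : measurable D ->
  F i (restrict_op D u) =
  restrict_op (X `&` sigma i @^-1` D : set (borelType Y)) (F i u).
Proof.
move=> mD; have uL := repr_sqint u.
have mXD : measurable (X `&` sigma i @^-1` D : set (borelType Y)).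
  by apply: measurableI; [exact: mX|exact: measurable_preimage_contraction].
rewrite comp_op_class ?sqint_restrict// restrict_opE ?sqint_pull//.
apply/eq_L2_class; rewrite ?sqint_pull ?sqint_restrict ?sqint_pull//.
apply: aeW => x Xx; rewrite /restrict_fun.
have -> : \1_(X `&` sigma i @^-1` D) x = \1_D (sigma i x) :> R.
  by rewrite !indicE in_setI mem_set.
by rewrite [LHS]mulrCA.
Qed.

End composition_operators.

(** * Existence and uniqueness *)

Theorem corollary2p23 (R : realType) (Y : completeMetricType R)
    (Y_separable : separable_space Y) (N : nat) (N_ge2 : (2 <= N)%N)
    (sigma : 'I_N -> Y -> Y)
    (sigma_contraction : forall i, lipschitz_contraction (sigma i))
    (X : set Y) (X_attractor : is_attractor sigma X)
    (mu : probability (borelType Y) R)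
    (mu_hutchinson : is_hutchinson_measure sigma mu) :
  let mX := attractor_measurable X_attractor in
  let H := L2 mu mX in
  let ip := L2_ip mu mX in
  let F (i : 'I_N) : H -> H := comp_op X_attractor mu i in
  let S (i : 'I_N) : H -> H := adjoint ip (F i) in
  let fixed (A : set Y -> H -> H) :=
    forall Delta : set Y, borel_subset X Delta ->
    forall h : H, A Delta h =
      \sum_(i < N) S i (A (X `&` sigma i @^-1` Delta) (adjoint ip (S i) h)) in
  exists A : set Y -> H -> H,
    [/\ is_povm ip X A, fixed A &
        forall B : set Y -> H -> H, is_povm ip X B -> fixed B ->
        forall Delta : set Y, borel_subset X Delta ->
        B Delta = A Delta].
Proof.
move=> mX H ip F S fixed.
have N_gt0 : (0 < N)%N by exact: ltnW.
have [_ cX _] := X_attractor.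
have sX i x : X x -> X (sigma i x) by move=> Xx; exact: (attractor_sub i X_attractor Xx).
have bF i : bounded_operator ip (F i).
  exact: (bounded_comp_op sigma_contraction X_attractor N_gt0 mu_hutchinson i).
have normF u : \sum_(i < N) complex.Re (ip (F i u) (F i u)) = complex.Re (ip u u).
  exact: (sq_norm_comp_op sigma_contraction N_gt0 mu_hutchinson).
have [bS SE] : (forall i, bounded_operator ip (S i)) /\
    (forall i u v, ip (F i u) v = ip u (S i v)).
  have adj i := adjoint_of_contraction (ip := ip)
    (linear_comp_op sigma_contraction mu_hutchinson i)
    (contraction_comp_op sigma_contraction N_gt0 mu_hutchinson i)
    (comp_op_weak_adjoint sigma_contraction N_gt0 mu_hutchinson i).
  by split => i; case: (adj i).
have SS i : adjoint ip (S i) = F i.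
  exact: (adjoint_adjoint (bF i) (SE i)).
have ip_SF i u v : ip (S i u) v = ip u (F i v).
  have ipC w z : ip w z = conjc (ip z w) by exact: ip_conj.
  by rewrite ipC -SE -ipC.
have sumSF h : \sum_(i < N) S i (F i h) = h.
  have lSF : linear (fun u => \sum_(i < N) S i (F i u)).
    move=> a u v; rewrite scaler_sumr -big_split /=; apply: eq_bigr => i _.
    by rewrite (bF i).1 (bS i).1.
  have lid : linear (fun u : H => u) by [].
  apply: (congr1 (@^~ h) (polarization (ip := ip) lSF lid _)) => u.
  rewrite linear_sumlz [RHS]ip_ReE -normF raddf_sum; apply: eq_bigr => i _.
  by apply: (etrans (ip_SF i (F i u) u)); exact: (ip_ReE ip (F i u)).
have ss (A : set Y -> H -> H) : fixed A -> self_similar sigma X ip F A.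
  move=> fA D mD h; have XD : borel_subset X (X `&` D) by exact: borel_subsetI.
  rewrite (fA _ XD) linear_sumlz; apply: eq_bigr => i _; rewrite SS.
  rewrite (_ : X `&` sigma i @^-1` (X `&` D) = X `&` sigma i @^-1` D); last first.
    by apply/seteqP; split => x /= [Xx]; [case|split => //; split => //; exact: sX].
  exact: ip_SF.
have povmA : is_povm ip X (@restrict_op _ _ _ mu _ mX).
  split.
  - by move=> D [mD _]; exact: bounded_restrict_op.
  - by move=> D [mD _]; exact: positive_restrict_op.
  - exact: restrict_op0.
  - exact: restrict_op_id.
  - by move=> D bD tD g h; apply: cvg_sum_restrict_op => // n; case: (bD n).
have fA : fixed (@restrict_op _ _ _ mu _ mX).
  move=> D [mD _] h; under eq_bigr => i _.
    rewrite SS -(comp_op_restrict sigma_contraction)//; over.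
  by rewrite sumSF.
exists (@restrict_op _ _ _ mu _ mX); split => // B povmB fB D bD.
exact: (self_similar_uniq sigma_contraction cX mX sX povmB povmA (ss _ fB) (ss _ fA)).
Qed.
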